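(* Let $n$ be a $p$-dimensional full zero-mean complex normal random vector whose circularity coefficients $\lambda_1,\ldots,\lambda_p$ satisfy $\lambda_k\neq1$ for $k=1,\ldots,p$. Then the differential entropy of $n$ is $$h(n)=\log\bigl(\det(\pi e\operatorname{cov}[n])\bigr)+\frac12\sum_{k=1}^p\log(1-\lambda_k^2).$$
   Context: A $p$-dimensional complex random vector is $x=x_R+\jmath x_I$ with $x_R,x_I$ real $p$-dimensional random vectors; put $x_{\mathbb{R}}=(x_R^T,x_I^T)^T\in\mathbb{R}^{2p}$. It is complex normal (wide sense) if $x_{\mathbb{R}}$ is multivariate normal. Its differential entropy $h(x)$ is the differential entropy of the real random vector $x_{\mathbb{R}}$ (natural logarithm). $x$ is full if the support of its distribution is not contained in any proper complex affine subspace of $\mathbb{C}^p$; for vectors with finite second moments this makes $\operatorname{cov}[x]$ positive definite. Define $\operatorname{cov}[x]=E[(x-Ex)(x-Ex)^H]$ and $\operatorname{pcov}[x]=E[(x-Ex)(x-Ex)^T]$. The circularity spectrum of a full $x$ with finite second moments is the unique vector $(\lambda_1,\ldots,\lambda_p)^T$, $\lambda_1\ge\cdots\ge\lambda_p\ge0$, for which there is a nonsingular complex $p\times p$ matrix $D$ with $\operatorname{cov}[Dx]=I_p$ and $\operatorname{pcov}[Dx]=\operatorname{diag}(\lambda_1,\ldots,\lambda_p)$; its entries are the circularity coefficients (they lie in $[0,1]$). *)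

(* Defs.v *)
From HB Require Import structures.
From mathcomp Require Import all_boot all_order all_algebra complex.
From mathcomp Require Import all_classical all_reals all_analysis.

Set Implicit Arguments.
Unset Strict Implicit.
Unset Printing Implicit Defensive.

Import Order.TTheory GRing.Theory Num.Theory.
Import numFieldNormedType.Exports.

Local Open Scope classical_set_scope.
Local Open Scope complex_scope.
Local Open Scope ring_scope.

Section product_of_measures.
Context d (T : measurableType d) (R : realType).
Variable mu : {sigma_finite_measure set T -> \bar R}.

Definition pair_cons n (z : T * n.-tuple T) : n.+1.-tuple T :=
  [the n.+1.-tuple T of z.1 :: z.2].

Lemma measurable_pair_cons n : measurable_fun setT (@pair_cons n).
Proof. exact: measurable_cons. Qed.

HB.instance Definition _ n := isMeasurableFun.Build _ _ _ _ (@pair_cons n)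
  (@measurable_pair_cons n).

Section step.
Variables (n : nat) (nu : {sigma_finite_measure set (n.-tuple T) -> \bar R}).

Definition cons_measure : set (n.+1.-tuple T) -> \bar R :=
  pushforward (mu \x nu)%E (@pair_cons n).

Let cons_measure0 : cons_measure set0 = 0%E.
Proof. exact: measure0. Qed.

Let cons_measure_ge0 A : (0 <= cons_measure A)%E.
Proof. exact: measure_ge0. Qed.

Let cons_measure_sigma_additive : semi_sigma_additive cons_measure.
Proof.
move=> F mF tF mUF; rewrite /cons_measure /pushforward preimage_bigcup.
have mpre k : measurable (@pair_cons n @^-1` F k).
  by rewrite -[X in measurable X]setTI; exact: measurable_pair_cons.
apply: measure_semi_sigma_additive => //; last exact: bigcup_measurable.
apply/trivIsetP => i j _ _ ij; rewrite -preimage_setI.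
by move/trivIsetP : tF => /(_ _ _ I I ij) ->; rewrite preimage_set0.
Qed.

HB.instance Definition _ := isMeasure.Build _ _ _ cons_measure
  cons_measure0 cons_measure_ge0 cons_measure_sigma_additive.

Let cons_measure_sigma_finite : sigma_finite setT cons_measure.
Proof.
have /sigma_finiteP[F [FT ndF Foo]] := sigma_finiteT mu.
have /sigma_finiteP[G [GT ndG Goo]] := sigma_finiteT nu.
pose uncons (t : n.+1.-tuple T) : T * n.-tuple T :=
  (thead t, [tuple of behead t]).
have unconsK z : uncons (pair_cons z) = z.
  by case: z => x t; congr pair; apply: val_inj.
have muncons : measurable_fun setT uncons.
  by apply: measurable_fun_pair; [exact: measurable_tnth
                                 |exact: measurable_behead].
exists (fun k => uncons @^-1` (F k `*` G k)).
  apply/seteqP; split => // t _.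
  have [i _ Fi] : (\bigcup_k F k) (uncons t).1 by rewrite -FT.
  have [j _ Gj] : (\bigcup_k G k) (uncons t).2 by rewrite -GT.
  exists (maxn i j) => //; split.
  - by move: Fi; exact/subsetPset/ndF/leq_maxl.
  - by move: Gj; exact/subsetPset/ndG/leq_maxr.
move=> k; have [mF Fk] := Foo k; have [mG Gk] := Goo k; split.
  by rewrite -[X in measurable X]setTI; apply: muncons => //; exact: measurableX.
rewrite /cons_measure /pushforward.
rewrite (_ : @pair_cons n @^-1` _ = F k `*` G k); last first.
  by rewrite -comp_preimage (_ : _ \o _ = id)//; exact/funext.
by rewrite product_measure1E// lte_mul_pinfty// ge0_fin_numE.
Qed.

HB.instance Definition _ := Measure_isSigmaFinite.Build _ _ _ cons_measure
  cons_measure_sigma_finite.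

End step.

Fixpoint tuple_measure n : {sigma_finite_measure set (n.-tuple T) -> \bar R} :=
  match n with
  | 0 => \d_([tuple] : 0.-tuple T)
  | n'.+1 => cons_measure (tuple_measure n')
  end.

Lemma tuple_measure_box n (A : 'I_n -> set T) :
  (forall i, measurable (A i)) ->
  tuple_measure n [set t | forall i, A i (tnth t i)] =
  (\prod_(i < n) mu (A i))%E.
Proof.
elim: n A => [|n IH] A mA /=.
  by rewrite big_ord0 diracE mem_set// => -[].
pose B := [set t : n.-tuple T | forall i, A (lift ord0 i) (tnth t i)].
have mB : measurable B.
  rewrite (_ : B = \bigcap_(i in [set: 'I_n])
      ((fun t : n.-tuple T => tnth t i) @^-1` A (lift ord0 i))).
    apply: fin_bigcap_measurable => // i _.
    rewrite -[X in measurable X]setTI.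
    exact: measurable_tnth.
  by apply/seteqP; split => t /= h i; [move=> _|]; exact: h.
rewrite /cons_measure /pushforward.
rewrite (_ : _ @^-1` _ = A ord0 `*` B).
  by rewrite product_measure1E// big_ord_recl -IH.
apply/seteqP; split => -[x t] /=.
- move=> h; split => [|i]; first exact: (h ord0).
  by have := h (lift ord0 i); rewrite tnthS.
- move=> [Ax Bt] i; case: (unliftP ord0 i) => [j ->|->//].
  by rewrite tnthS; exact: Bt.
Qed.

End product_of_measures.

Section real_random_vectors.
Context (R : realType).

(* measurableTypeR R is R with its Borel sets, on which lebesgue_measure and
   normal_prob are defined. *)
Definition lebesgueRn n := tuple_measure (@lebesgue_measure R) n.

(* The law of n independent standard real normal variables. *)
Definition std_normalRn n := tuple_measure (normal_prob (0 : R) 1) n.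

Definition cV_of_tuple n (t : n.-tuple (measurableTypeR R)) : 'cV[R]_n := \col_i tnth t i.
Definition tuple_of_cV n (v : 'cV[R]_n) : n.-tuple (measurableTypeR R) :=
  [tuple v i ord0 | i < n].

Context d (T : measurableType d) (P : probability T R).

(* X has the law of A Z + m with Z standard normal on R^l; A may have any rank,
   so that degenerate normal vectors are included. *)
Definition multivariate_normal n (X : {RV P >-> n.-tuple (measurableTypeR R)}) : Prop :=
  exists (l : nat) (A : 'M[R]_(n, l)) (m : 'cV[R]_n),
    forall B, measurable B ->
      distribution P X B =
      std_normalRn l [set z | B (tuple_of_cV (A *m cV_of_tuple z + m))].

(* - \int f log f where f is the density of X with respect to Lebesgue measure,
   and -oo if X has no density. As +oo - +oo = -oo in \bar R, the value is
   finite only if f log f is integrable. *)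
Definition differential_entropy n (X : {RV P >-> n.-tuple (measurableTypeR R)}) : \bar R :=
  if pselect (distribution P X `<< lebesgueRn n) then
    (- \int[lebesgueRn n]_z
        let f := fine (Radon_Nikodym
          (charge_of_finite_measure (distribution P X)) (lebesgueRn n) z) in
        (f * ln f)%:E)%E
  else -oo%E.

End real_random_vectors.

Section complex_random_vectors.
Context (R : realType) d (T : measurableType d) (P : probability T R).

Record complexRV (p : nat) := ComplexRV {
  re_part : {RV P >-> p.-tuple (measurableTypeR R)} ;
  im_part : {RV P >-> p.-tuple (measurableTypeR R)} }.

Definition cvect p (x : complexRV p) (w : T) : 'cV[R[i]]_p :=
  \col_k (tnth (re_part x w) k +i* tnth (im_part x w) k).

Definition stack p (x : complexRV p) (w : T) :
    (p + p).-tuple (measurableTypeR R) :=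
  [tuple of re_part x w ++ im_part x w].

Lemma measurable_stack p (x : complexRV p) : measurable_fun setT (stack x).
Proof.
apply/measurable_fun_tnthP => k; rewrite -(splitK k).
case: (fintype.split k) => j /=.
- rewrite (_ : _ \o _ = (@tnth _ (measurableTypeR R) ^~ j) \o re_part x).
    by apply: measurableT_comp => //; exact: measurable_tnth.
  by apply/funext => w /=; rewrite tnth_lshift.
- rewrite (_ : _ \o _ = (@tnth _ (measurableTypeR R) ^~ j) \o im_part x).
    by apply: measurableT_comp => //; exact: measurable_tnth.
  by apply/funext => w /=; rewrite tnth_rshift.
Qed.

HB.instance Definition _ p (x : complexRV p) :=
  isMeasurableFun.Build _ _ _ _ (stack x) (measurable_stack x).

Definition realRV p (x : complexRV p) : {RV P >-> (p + p).-tuple (measurableTypeR R)} := stack x.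

Definition complex_normal p (x : complexRV p) : Prop :=
  multivariate_normal (realRV x).

Definition entropy p (x : complexRV p) : \bar R :=
  differential_entropy (realRV x).

(* R[i]^o carries the topology of the complex modulus. *)
Definition distr_support p (x : complexRV p) : set 'cV[R[i]]_p :=
  [set z | forall U : set 'cV[R[i]^o]_p, open U -> U z ->
     (0 < P [set w | U (cvect x w)])%E].

Definition full p (x : complexRV p) : Prop :=
  ~ exists (a : 'cV[R[i]]_p) (V : {vspace 'cV[R[i]]_p}),
      V != fullv /\ forall z, distr_support x z -> z - a \in V.

(* Entrywise complex expectation; meaningful when the entries are integrable
   (fine sends infinite values to 0), which holds for normal vectors and their
   quadratic expressions below. *)
Definition cexpectation m n (Y : T -> 'M[R[i]]_(m, n)) : 'M[R[i]]_(m, n) :=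
  \matrix_(i, j) (fine 'E_P[fun w => complex.Re (Y w i j)]
                  +i* fine 'E_P[fun w => complex.Im (Y w i j)]).

Definition hermitian_transpose m n (A : 'M[R[i]]_(m, n)) : 'M[R[i]]_(n, m) :=
  (map_mx Num.conj A)^T.

Definition cov p (x : T -> 'cV[R[i]]_p) : 'M[R[i]]_p :=
  cexpectation (fun w => (x w - cexpectation x)
    *m hermitian_transpose (x w - cexpectation x)).

Definition pcov p (x : T -> 'cV[R[i]]_p) : 'M[R[i]]_p :=
  cexpectation (fun w => (x w - cexpectation x) *m (x w - cexpectation x)^T).

Definition circularity_spectrum p (x : complexRV p) (lambda : 'rV[R]_p) : Prop :=
  [/\ forall j k : 'I_p, (j <= k)%N -> lambda ord0 k <= lambda ord0 j,
      forall k, 0 <= lambda ord0 k &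
      exists2 D : 'M[R[i]]_p, D \in unitmx &
        cov (fun w => D *m cvect x w) = 1%:M /\
        pcov (fun w => D *m cvect x w) = diag_mx (map_mx (real_complex R) lambda)].

End complex_random_vectors.

(* Main.v *)
(* Writing the law of the stacked real vector as that of A Z with Z standard
   normal, G = A A^T is its second-moment matrix. The real form F of the
   whitening matrix D gives F G F^T = diag((1 + lambda)/2, (1 - lambda)/2),
   which is positive definite because G is positive semidefinite and no lambda_k
   is 1. Hence G = W W^T with W = F^-1 diag(...)^(1/2) invertible, and W^-1 A has
   orthonormal rows, so that A Z has the law of W Z' with Z' standard normal in
   dimension 2p. A linear change of variables gives the density of W Z' and its
   entropy ln |det W| + p (1 + ln (2 pi)); finally det F = |det D|^2 is the
   inverse of det cov[n]. *)
From HB Require Import structures.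
Require Import Defs.
From mathcomp Require Import all_boot all_order all_algebra complex.
From mathcomp Require Import all_classical all_reals all_analysis.
From mathcomp Require Import measurable_realfun ring lra.
Set Implicit Arguments.
Unset Strict Implicit.
Unset Printing Implicit Defensive.

Import Order.TTheory GRing.Theory Num.Theory.
Import numFieldNormedType.Exports.
Local Open Scope classical_set_scope.
Local Open Scope complex_scope.
Local Open Scope ring_scope.

(** * Tuple measures and boxes *)
Section tuple_boxes.
Context d (T : measurableType d) (R : realType).

(** The obstacle is that normality only provides a law A Z + m with A rectangular and of unknown
    rank, whereas the entropy refers to a Radon-Nikodym derivative for an iterated product measure.
    No density can be read off A; the circularity spectrum is what makes G invertible, and replacing
    A by the square W is what makes a change of variables possible. The entries (1 + lambda)/2 and
    (1 - lambda)/2 are the variances of the real and imaginary parts of a whitened coordinate: the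
    covariance prescribes their sum 1, the pseudo-covariance their difference lambda. Their product
    (1 - lambda^2)/4 explains the final formula: half the sum of its logarithms is the sum over
    log(1 - lambda^2), halved, minus p ln 2, which turns the real constant (2 pi e)^p into (pi
    e)^p. *)

Definition box n (A : 'I_n -> set T) : set (n.-tuple T) :=
  [set t | forall i, A i (tnth t i)].

Lemma measurable_box n (A : 'I_n -> set T) :
  (forall i, measurable (A i)) -> measurable (box A).
Proof.
move=> mA; rewrite (_ : box A = \bigcap_(i in [set: 'I_n])
    ((fun t : n.-tuple T => tnth t i) @^-1` A i)).
  apply: fin_bigcap_measurable => // i _.
  by rewrite -[X in measurable X]setTI; exact: measurable_tnth.
by apply/seteqP; split => t /= h i; [move=> _|]; exact: h.
Qed.

(** Unlike preimages under single coordinates, boxes are stable under intersection, as the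
    uniqueness theorem for measures requires of a generating family. *)
Lemma tuple_measurableE n : @measurable _ (n.-tuple T) =
  <<s [set B | exists2 A : 'I_n -> set T, (forall i, measurable (A i)) & B = box A] >>.
Proof.
rewrite /measurable/= /g_sigma_preimage; apply/seteqP; split.
- apply: smallest_sub; first exact: smallest_sigma_algebra.
  move=> X; rewrite -bigcup_seq => -[/= i _ [Y mY <-]].
  apply: sub_sigma_algebra; exists (fun j => if j == i then Y else setT).
    by move=> j; case: ifP => _; [exact: mY | exact: measurableT].
  apply/seteqP; split => t /=.
    by move=> [_ Yt] j; case: eqP => // ->.
  by move=> /(_ i); rewrite eqxx.
- apply: smallest_sub.
    exact: (@smallest_sigma_algebra _ setT).
  by move=> _ [A mA ->]; exact: measurable_box.
Qed.

Lemma finite_measure_box_unique n (m1 m2 : {measure set (n.-tuple T) -> \bar R}) :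
  (m1 setT < +oo)%E ->
  (forall A : 'I_n -> set T, (forall i, measurable (A i)) -> m1 (box A) = m2 (box A)) ->
  forall B, measurable B -> m1 B = m2 B.
Proof.
move=> m1oo m12 B mB.
apply: (measure_unique _ (fun=> setT) (@tuple_measurableE n)) => //.
- move=> _ _ [A mA ->] [A' mA' ->]; exists (fun i => A i `&` A' i).
    by move=> i; exact: measurableI.
  apply/seteqP; split => t /=; first by move=> [h h'] i; split; [exact: h|exact: h'].
  by move=> h; split => i; case: (h i).
- by move=> _; exists (fun=> setT) => //; apply/seteqP; split.
- by apply/seteqP; split => // t _; exists 0.
- by move=> _ [A mA ->]; exact: m12.
Qed.

End tuple_boxes.

(** * Affine maps and Fubini on tuples *)

(** Names the bundled measure structure of a pushforward, so that it can be given to lemmas that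
    expect a measure. *)
Definition image_measure d1 d2 (T1 : measurableType d1) (T2 : measurableType d2)
    (R : realType) (mu : {measure set T1 -> \bar R}) (f : T1 -> T2)
    (mf : measurable_fun setT f) : {measure set T2 -> \bar R} :=
  measure_function_pushforward__canonical__measure_function_Measure mu mf.

(** By uniqueness of Lebesgue measure it suffices to compare both sides on intervals []u, v]]. *)
Lemma lebesgue_measure_affine (R : realType) (a b : R) (A : set (measurableTypeR R)) :
  a != 0 -> measurable A ->
  (`|a|%:E * lebesgue_measure [set x : measurableTypeR R | A (a * x + b)%R] =
   lebesgue_measure A)%E.
Proof.
move=> a0 mA.
pose aff (x : measurableTypeR R) : measurableTypeR R := a * x + b.
have maff : measurable_fun setT aff.
  by apply: measurable_funD => //; exact: measurable_funM.
have a_ge0 : 0 <= `|a| by [].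
pose k : {nonneg R} := NngNum a_ge0.
apply/esym.
have := @lebesgue_measure_unique R (mscale k (image_measure lebesgue_measure maff)).
move=> /(_ _ A mA) -> // _ [[u v]] _ <-.
change (lebesgue_measure (`]u, v]%classic : set (measurableTypeR R)) =
  `|a|%:E * lebesgue_measure (aff @^-1` `]u, v]))%E.
have [apos|] := ltP 0 a.
  rewrite (_ : aff @^-1` `]u, v] = `](u - b) / a, (v - b) / a]%classic); last first.
    by apply/seteqP; split => x /=; rewrite /aff !in_itv/= ltr_pdivrMr// ler_pdivlMr// mulrC ltrBlDr lerBrDr.
  rewrite !lebesgue_measure_itv/= !lte_fin ltr_pM2r ?invr_gt0// ltrD2r.
  case: ifP => _; last by rewrite mule0.
  rewrite -EFinD -EFinM; congr EFin; rewrite gtr0_norm//; by field.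
rewrite le_eqVlt (negbTE a0)/= => aneg.
(* A negative slope swaps the endpoints and also the side on which the interval is closed, which
   does not affect its length. *)
rewrite (_ : aff @^-1` `]u, v] = `[(v - b) / a, (u - b) / a[%classic); last first.
  by apply/seteqP; split => x /=; rewrite /aff !in_itv/= ltr_ndivlMr// ler_ndivrMr// mulrC ltrBlDr lerBrDr andbC.
rewrite !lebesgue_measure_itv/= !lte_fin ltr_nM2r ?invr_lt0// ltrD2r.
case: ifP => _; last by rewrite mule0.
rewrite -EFinD -EFinM; congr EFin; rewrite ltr0_norm//; by field.
Qed.

Lemma ge0_integral_affine (R : realType) (a b : R) (f : measurableTypeR R -> \bar R) :
  a != 0 -> measurable_fun setT f -> (forall x, 0 <= f x)%E ->
  (`|a|%:E * \int[lebesgue_measure]_x f (a * x + b)%R =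
   \int[lebesgue_measure]_x f x)%E.
Proof.
move=> a0 mf f0.
pose aff (x : measurableTypeR R) : measurableTypeR R := a * x + b.
have maff : measurable_fun setT aff.
  by apply: measurable_funD => //; exact: measurable_funM.
have a_ge0 : 0 <= `|a| by [].
pose k : {nonneg R} := NngNum a_ge0.
transitivity (\int[mscale k (image_measure lebesgue_measure maff)]_x f x)%E.
  by rewrite ge0_integral_mscale//= ge0_integral_pushforward.
by apply: eq_measure_integral => A mA _; exact: lebesgue_measure_affine.
Qed.

Section tuple_measure_integral.
Context d (T : measurableType d) (R : realType).
Variable mu : {sigma_finite_measure set T -> \bar R}.
Variables (n : nat) (f : n.+1.-tuple T -> \bar R).
Hypotheses (mf : measurable_fun setT f) (f0 : forall t, (0 <= f t)%E).

Lemma measurable_comp_pair_cons : measurable_fun setT (f \o @pair_cons d T n).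
Proof. by apply: measurableT_comp => //; exact: measurable_pair_cons. Qed.

Lemma ge0_integral_tuple_measureS :
  (\int[tuple_measure mu n.+1]_t f t =
   \int[mu]_x \int[tuple_measure mu n]_t f (pair_cons (x, t)))%E.
Proof.
rewrite (ge0_integral_pushforward (@measurable_pair_cons _ T n))//=.
rewrite (fubini_tonelli1 (f \o @pair_cons d T n))//.
- exact: measurable_comp_pair_cons.
- by move=> x /=.
Qed.

(** This order, with the head integrated innermost, suits maps that alter only the first
    coordinate. *)
Lemma ge0_integral_tuple_measureS_swap :
  (\int[tuple_measure mu n.+1]_t f t =
   \int[tuple_measure mu n]_t \int[mu]_x f (pair_cons (x, t)))%E.
Proof.
rewrite ge0_integral_tuple_measureS.
rewrite (fubini_tonelli (f \o @pair_cons d T n))//.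
- exact: measurable_comp_pair_cons.
- by move=> x /=.
Qed.

End tuple_measure_integral.

Section affine_maps.
Context (R : realType).
Notation RR := (measurableTypeR R).

Definition affine_map n l (M : 'M[R]_(n, l)) (b : 'cV[R]_n) (z : l.-tuple RR) :
    n.-tuple RR :=
  tuple_of_cV (M *m cV_of_tuple z + b).

Lemma tuple_of_cVK n : cancel (@tuple_of_cV R n) (@cV_of_tuple R n).
Proof. by move=> v; apply/colP => i; rewrite mxE tnth_mktuple. Qed.

Lemma cV_of_tupleK n : cancel (@cV_of_tuple R n) (@tuple_of_cV R n).
Proof. by move=> t; apply: eq_from_tnth => i; rewrite tnth_mktuple mxE. Qed.

Lemma tnth_affine_map n l (M : 'M[R]_(n, l)) b z i :
  tnth (affine_map M b z) i = \sum_j M i j * tnth z j + b i ord0.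
Proof.
rewrite tnth_mktuple !mxE; congr (_ + _).
by apply: eq_bigr => j _; rewrite mxE.
Qed.

Lemma measurable_affine_map n l (M : 'M[R]_(n, l)) b :
  measurable_fun setT (affine_map M b).
Proof.
apply/measurable_fun_tnthP => i.
rewrite (_ : _ \o _ = fun z => \sum_j M i j * tnth z j + b i ord0); last first.
  by apply/funext => z /=; rewrite tnth_affine_map.
apply: measurable_funD => //.
apply: measurable_sum => j; apply: measurable_funM => //.
exact: measurable_tnth.
Qed.

Lemma affine_map_comp n l k (M : 'M[R]_(n, l)) (N : 'M[R]_(l, k)) b c z :
  affine_map M b (affine_map N c z) = affine_map (M *m N) (M *m c + b) z.
Proof. by rewrite /affine_map tuple_of_cVK mulmxDr mulmxA addrA. Qed.

Lemma cV_of_tuple_cons n (x : RR) (t : n.-tuple RR) :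
  cV_of_tuple (pair_cons (x, t)) = col_mx (x%:M : 'M[R]_1) (cV_of_tuple t) :> 'cV[R]_(1 + n).
Proof.
apply/colP => i; case: (split_ordP i) => j ->; rewrite !mxE.
- by rewrite (unsplitK (inl j))/= ord1 !mxE.
- by rewrite (unsplitK (inr j))/= !mxE rshift1 tnthS.
Qed.

Lemma tuple_of_cV_col_mx n (x : R) (v : 'cV[R]_n) :
  tuple_of_cV (col_mx (x%:M : 'M[R]_1) v : 'cV[R]_(1 + n)) = pair_cons (x : RR, tuple_of_cV v).
Proof.
apply: (can_inj (@cV_of_tupleK _)).
by rewrite tuple_of_cVK cV_of_tuple_cons tuple_of_cVK.
Qed.

End affine_maps.

(** * Linear change of variables *)

Section affine_change_of_variables.
Context (R : realType).
Notation RR := (measurableTypeR R).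

(** Nonnegative integrands let Tonelli apply without integrability. Being a property of affine maps
    that is closed under composition, it can be checked on the factors of a matrix. *)
Definition affine_cov n (M : 'M[R]_n) (b : 'cV[R]_n) : Prop :=
  forall f : n.-tuple RR -> \bar R,
    measurable_fun setT f -> (forall t, 0 <= f t)%E ->
    (`|\det M|%:E * \int[lebesgueRn R n]_z f (affine_map M b z) =
     \int[lebesgueRn R n]_z f z)%E.

Lemma affine_cov_comp n (M N : 'M[R]_n) b c :
  affine_cov M b -> affine_cov N c -> affine_cov (M *m N) (M *m c + b).
Proof.
move=> cM cN f mf f0.
rewrite -(cM f mf f0) -(cN (f \o affine_map M b)) => [|| t /=]; last exact: f0.
- rewrite det_mulmx normrM EFinM -muleA; congr (_ * (_ * _))%E.
  by apply: eq_integral => z _ /=; rewrite affine_map_comp.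
- by apply: measurableT_comp => //; exact: measurable_affine_map.
Qed.

Lemma affine_map_lower n (c : 'cV[R]_n) (S : 'M[R]_n) (b : 'cV[R]_n) x t :
  affine_map (block_mx (1%:M : 'M[R]_1) 0 c S) (col_mx (0 : 'M[R]_1) b) (pair_cons (x, t)) =
  pair_cons (x, affine_map S (x *: c + b) t) :> (1 + n).-tuple RR.
Proof.
rewrite /affine_map cV_of_tuple_cons mul_block_col mul1mx mul0mx add_col_mx !addr0.
by rewrite tuple_of_cV_col_mx mul_mx_scalar addrA [_ + x *: c]addrC.
Qed.

Lemma affine_map_upper n (a b : R) (r : 'rV[R]_n) (x : RR) t :
  affine_map (block_mx (a%:M : 'M[R]_1) r 0 1%:M) (col_mx (b%:M : 'M[R]_1) 0)
    (pair_cons (x, t)) =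
  pair_cons (a * x + ((r *m cV_of_tuple t) ord0 ord0 + b) : RR, t) :> (1 + n).-tuple RR.
Proof.
rewrite /affine_map cV_of_tuple_cons mul_block_col mul1mx mul0mx add_col_mx addr0 add0r.
rewrite [r *m _]mx11_scalar -scalar_mxM -!raddfD/= tuple_of_cV_col_mx cV_of_tupleK.
by rewrite -mx11_scalar addrA.
Qed.

(** For a fixed head x, the tail undergoes the affine map with matrix S and translation
    [x *: c + b]; as x varies, S has to be handled with every translation. *)
Lemma affine_cov_lower n (c : 'cV[R]_n) (S : 'M[R]_n) (b : 'cV[R]_n) :
  (forall b', affine_cov S b') ->
  affine_cov (block_mx (1%:M : 'M[R]_1) 0 c S : 'M[R]_n.+1)
    (col_mx (0 : 'M[R]_1) b : 'cV[R]_n.+1).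
Proof.
move=> cS f mf f0.
rewrite (det_lblock (1%:M : 'M[R]_1) c S) det1 mul1r /lebesgueRn !ge0_integral_tuple_measureS//; last first.
  by apply: measurableT_comp => //; exact: measurable_affine_map.
rewrite -ge0_integralZl//; first last.
- by move=> x _; exact: integral_ge0.
- pose M : 'M[R]_n.+1 := block_mx (1%:M : 'M[R]_1) 0 c S.
  pose v : 'cV[R]_n.+1 := col_mx (0 : 'M[R]_1) b.
  apply: (measurable_fun_fubini_tonelli_F (f \o affine_map M v \o @pair_cons _ RR n)).
  + apply: measurable_comp_pair_cons; apply: measurableT_comp => //.
    exact: measurable_affine_map.
  + by move=> z; exact: f0.
apply: eq_integral => x _.
under eq_integral do rewrite (affine_map_lower c S b x).
apply: (cS _ (fun t => f (pair_cons (x, t)))) => //.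
apply: (@measurableT_comp _ _ _ _ _ _ (f \o @pair_cons _ RR n)) => //.
exact: measurable_comp_pair_cons.
Qed.

(** For a fixed tail, the head undergoes a one-dimensional affine map of slope a. *)
Lemma affine_cov_upper n (a b : R) (r : 'rV[R]_n) : a != 0 ->
  affine_cov (block_mx (a%:M : 'M[R]_1) r 0 1%:M : 'M[R]_n.+1)
    (col_mx (b%:M : 'M[R]_1) 0 : 'cV[R]_n.+1).
Proof.
move=> a0 f mf f0.
rewrite (det_ublock (a%:M : 'M[R]_1) r) det1 mulr1 det_scalar1 /lebesgueRn !ge0_integral_tuple_measureS_swap//; last first.
  by apply: measurableT_comp => //; exact: measurable_affine_map.
rewrite -ge0_integralZl//; first last.
- by move=> x _; exact: integral_ge0.
- pose M : 'M[R]_n.+1 := block_mx (a%:M : 'M[R]_1) r 0 1%:M.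
  pose v : 'cV[R]_n.+1 := col_mx (b%:M : 'M[R]_1) 0.
  apply: (measurable_fun_fubini_tonelli_G (f \o affine_map M v \o @pair_cons _ RR n)).
  + apply: measurable_comp_pair_cons; apply: measurableT_comp => //.
    exact: measurable_affine_map.
  + by move=> z; exact: f0.
apply: eq_integral => t _.
under eq_integral do rewrite (affine_map_upper a b r).
apply: (@ge0_integral_affine R a _ (fun x => f (pair_cons (x, t)))) => //.
apply: (@measurableT_comp _ _ _ _ _ _ (f \o @pair_cons _ RR n)) => //.
exact: measurable_comp_pair_cons.
Qed.

(** Block LU factorisation at the pivot a, with S the Schur complement, reduces M to the two
    triangular cases. *)
Lemma affine_cov_pivot n (M : 'M[R]_(1 + n)) (b : 'cV[R]_(1 + n)) :
  (forall (S : 'M[R]_n) b', S \in unitmx -> affine_cov S b') ->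
  M \in unitmx -> M 0 0 != 0 -> affine_cov (M : 'M[R]_n.+1) b.
Proof.
move=> IH uM a0; set a := M 0 0 in a0.
pose r := ursubmx M; pose c := dlsubmx M.
pose S := drsubmx M - a^-1 *: (c *m r).
pose L : 'M[R]_(1 + n) := block_mx 1%:M 0 (a^-1 *: c) S.
pose U : 'M[R]_(1 + n) := block_mx a%:M r 0 1%:M.
have MLU : M = L *m U.
  rewrite /L /U mulmx_block !mul1mx !mul0mx !mulmx0 !mulmx1 !addr0.
  rewrite -[M in LHS]submxK; congr block_mx.
  - by rewrite [LHS]mx11_scalar !mxE !lshift0.
  - by rewrite mul_mx_scalar scalerA divff// scale1r.
  - by rewrite -scalemxAl addrCA subrr addr0.
have uS : S \in unitmx.
  move: uM; rewrite MLU unitmx_mul => /andP[+ _].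
  by rewrite unitmxE det_lblock det1 mul1r -unitmxE.
(* The factor U carries the first entry of b as its translation; L then spreads [(b 0 0 / a) *: c]
   into the tail, and v compensates for it. *)
pose v : 'cV[R]_n := dsubmx b - (b 0 0 / a) *: c.
have -> : b = L *m col_mx (b 0 0)%:M 0 + col_mx 0 v.
  rewrite /L mul_block_col !mul1mx !mulmx0 !addr0 add_col_mx addr0.
  rewrite -[b in LHS]vsubmxK; congr col_mx.
    by rewrite [LHS]mx11_scalar !mxE !lshift0.
  by rewrite mul_mx_scalar scalerA addrC subrK.
rewrite {1}MLU; apply: affine_cov_comp.
- by apply: affine_cov_lower => b'; exact: IH.
- exact: affine_cov_upper.
Qed.

Theorem affine_change_of_variables n (M : 'M[R]_n) (b : 'cV[R]_n) :
  M \in unitmx -> affine_cov M b.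
Proof.
elim: n M b => [|n IH] M b uM.
  move=> f mf f0; rewrite det_mx00 normr1 mul1e; apply: eq_integral => z _.
  by congr f; apply: eq_from_tnth => -[].
have [M00|] := eqVneq (M ord0 ord0) 0; last exact: (@affine_cov_pivot n).
(* With a zero pivot, an invertible M still has a nonzero entry in its first column. *)
have [i Mi] : exists i : 'I_n, M (lift ord0 i) ord0 != 0.
  apply/existsP; apply: contraLR uM => /existsPn Mi0.
  rewrite unitmxE (expand_det_col _ ord0) big1 ?unitr0// => i _.
  case: (unliftP ord0 i) => [j ->|->]; last by rewrite M00 mul0r.
  by move: (Mi0 j); rewrite negbK => /eqP ->; rewrite mul0r.
(* The transvection [e 1] adds the row found above to the first row, which creates a pivot; [e (-1)]
   undoes it and is itself covered by the upper triangular case. *)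
pose e (s : R) : 'M[R]_(1 + n) := block_mx 1%:M (s *: delta_mx 0 i) 0 1%:M.
have eNK k (A : 'M[R]_(1 + n, k)) : e (-1) *m (e 1 *m A) = A.
  rewrite mulmxA /e mulmx_block !mul1mx !mul0mx !mulmx0 !mulmx1 !addr0 !add0r.
  by rewrite scaleN1r scale1r subrr -scalar_mx_block mul1mx.
have eM0 : (e 1 *m (M : 'M[R]_(1 + n))) 0 0 != 0.
  suff -> : (e 1 *m (M : 'M[R]_(1 + n))) 0 0 = M (lift ord0 i) ord0 by [].
  have e1 j : e 1 ord0 (lift ord0 j) = (j == i)%:R.
    rewrite -rshift1 (_ : ord0 = lshift n (ord0 : 'I_1)); last exact: val_inj.
    by rewrite block_mxEur !mxE eqxx mul1r.
  rewrite mxE big_ord_recl M00 mulr0 add0r (bigD1 i)//= big1 => [|j ji].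
    by rewrite e1 eqxx mul1r addr0.
  by rewrite e1 (negbTE ji) mul0r.
have -> : b = e (-1) *m (e 1 *m (b : 'cV[R]_(1 + n))) + col_mx 0%:M 0.
  by rewrite eNK raddf0 col_mx0 addr0.
rewrite -[M](eNK _ (M : 'M[R]_(1 + n))); apply: affine_cov_comp.
  by apply: affine_cov_upper; exact: oner_neq0.
apply: affine_cov_pivot => //.
by rewrite unitmx_mul uM andbT unitmxE det_ublock !det1 mulr1 unitr1.
Qed.

End affine_change_of_variables.

(** * Densities and the standard normal law *)

Section density.
Context d (T : measurableType d) (R : realType).
Variables (nu : {finite_measure set T -> \bar R})
          (mu : {sigma_finite_measure set T -> \bar R}) (f : T -> R).
Hypotheses (mf : measurable_fun setT f) (f0 : forall x, 0 <= f x).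
Hypothesis nuE : forall A, measurable A -> nu A = (\int[mu]_(x in A) (f x)%:E)%E.

Lemma density_dominates : nu `<< mu.
Proof.
apply/null_content_dominatesP => A mA muA0; rewrite nuE//.
apply: null_set_integral => //.
by apply/measurable_EFinP; exact: measurable_funTS.
Qed.

Lemma density_integrable : mu.-integrable setT (EFin \o f).
Proof.
apply/integrableP; split; first exact/measurable_EFinP.
under eq_integral do rewrite /= ger0_norm//.
by rewrite -(nuE measurableT) ltey_eq fin_num_measure.
Qed.

(** Both functions are integrable, f because nu is finite, and they have the same integral over
    every measurable set. *)
Lemma ae_eq_density_Radon_Nikodym :
  ae_eq mu setT (EFin \o f) (Radon_Nikodym (charge_of_finite_measure nu) mu).
Proof.
apply: integral_ae_eq => //.
- exact: density_integrable.
- exact/measurable_int/Radon_Nikodym_integrable/density_dominates.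
- move=> A _ mA; rewrite -Radon_Nikodym_integral//; first exact/esym/nuE.
  exact: density_dominates.
Qed.

Lemma ge0_integral_density (g : T -> \bar R) :
  measurable_fun setT g -> (forall x, 0 <= g x)%E ->
  (\int[nu]_x g x = \int[mu]_x (g x * (f x)%:E))%E.
Proof.
move=> mg g0.
rewrite -(Radon_Nikodym_SigmaFinite.change_of_variables density_dominates)//.
have mRN : measurable_fun setT (Radon_Nikodym_SigmaFinite.f nu mu).
  exact/measurable_int/(Radon_Nikodym_SigmaFinite.f_integrable density_dominates).
apply: ae_eq_integral => //.
- exact: emeasurable_funM.
- by apply: emeasurable_funM => //; exact/measurable_EFinP.
- apply: ae_eqe_mul2l.
  apply: ae_eq_trans (ae_eq_Radon_Nikodym_SigmaFinite density_dominates measurableT) _.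
  exact/ae_eq_sym/ae_eq_density_Radon_Nikodym.
Qed.

End density.

Section standard_normal_law.
Context (R : realType).
Notation RR := (measurableTypeR R).

Definition std_normal_pdf n (t : n.-tuple RR) : R :=
  \prod_(i < n) normal_pdf 0 1 (tnth t i).

Lemma std_normal_pdf_ge0 n (t : n.-tuple RR) : 0 <= std_normal_pdf t.
Proof. by apply: prodr_ge0 => i _; exact: normal_pdf_ge0. Qed.

Lemma measurable_std_normal_pdf n : measurable_fun setT (@std_normal_pdf n).
Proof.
apply: measurable_prod => i _.
apply: measurableT_comp; first exact: measurable_normal_pdf.
exact: measurable_tnth.
Qed.

Lemma std_normal_pdf_cons n x (t : n.-tuple RR) :
  std_normal_pdf (pair_cons (x, t)) = normal_pdf 0 1 x * std_normal_pdf t.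
Proof.
rewrite /std_normal_pdf big_ord_recl; congr (_ * _).
by apply: eq_bigr => i _; rewrite tnthS.
Qed.

(** This form exhibits the density as a function of the Euclidean norm alone, the source of
    orthogonal invariance. *)
Lemma std_normal_pdfE n (t : n.-tuple RR) :
  std_normal_pdf t =
  normal_peak 1 ^+ n * expR (- (\sum_(i < n) tnth t i ^+ 2) / 2).
Proof.
rewrite mulNr -mulrN mulr_suml expR_sum -[X in _ ^+ X]card_ord -prodr_const.
rewrite -big_split; apply: eq_bigr => i _ /=.
rewrite normal_pdfE ?oner_neq0// /normal_fun subr0 expr1n.
by rewrite mulrN mulNr.
Qed.

(** Tonelli peels off one coordinate, whose law has a known density, and the product density factors
    in the same way. *)
Lemma ge0_integral_std_normalRn n (g : n.-tuple RR -> \bar R) :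
  measurable_fun setT g -> (forall x, 0 <= g x)%E ->
  (\int[std_normalRn R n]_z g z =
   \int[lebesgueRn R n]_z (g z * (std_normal_pdf z)%:E))%E.
Proof.
elim: n g => [|n IH] g mg g0.
  by apply: eq_integral => z _; rewrite /std_normal_pdf big_ord0 mule1.
have mgc (x : RR) : measurable_fun setT (fun t : n.-tuple RR => g (pair_cons (x, t))).
  apply: (@measurableT_comp _ _ _ _ _ _ (g \o @pair_cons _ RR n)) => //.
  exact: measurable_comp_pair_cons.
have mp := @measurable_std_normal_pdf.
rewrite /std_normalRn /lebesgueRn !ge0_integral_tuple_measureS//; first last.
- by move=> t; rewrite mule_ge0// lee_fin std_normal_pdf_ge0.
- by apply: emeasurable_funM => //; apply/measurable_EFinP; exact: mp.
etransitivity.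
  apply: (@ge0_integral_density _ _ _ (normal_prob 0 1) lebesgue_measure (normal_pdf 0 1)).
  - exact: measurable_normal_pdf.
  - by move=> x; exact: normal_pdf_ge0.
  - by [].
  - apply: (measurable_fun_fubini_tonelli_F (g \o @pair_cons _ RR n)).
    + exact: measurable_comp_pair_cons.
    + by move=> z; exact: g0.
  - by move=> x; exact: integral_ge0.
apply: eq_integral => x _; rewrite (IH _ (mgc x))// muleC -ge0_integralZl//; first last.
- by rewrite lee_fin normal_pdf_ge0.
- by move=> t _; rewrite mule_ge0// lee_fin std_normal_pdf_ge0.
- by apply: emeasurable_funM => //; apply/measurable_EFinP; exact: mp.
by apply: eq_integral => t _; rewrite std_normal_pdf_cons EFinM muleCA.
Qed.

Lemma std_normalRnT n : std_normalRn R n setT = 1%E.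
Proof.
rewrite (_ : setT = [set t : n.-tuple RR | forall i : 'I_n, setT (tnth t i)]).
  rewrite /std_normalRn (@tuple_measure_box _ _ _ (normal_prob 0 1) n (fun=> setT))// big1// => i _.
  exact: probability_setT.
by apply/seteqP; split.
Qed.

Lemma std_normalRn_affine n (M : 'M[R]_n) (b : 'cV[R]_n) A :
  M \in unitmx -> measurable A ->
  std_normalRn R n (affine_map M b @^-1` A) =
  (\int[lebesgueRn R n]_(y in A)
     (`|\det M|^-1 * std_normal_pdf (affine_map (invmx M) (- (invmx M *m b)) y))%:E)%E.
Proof.
move=> uM mA.
have detM0 : `|\det M| != 0 by rewrite normr_eq0 -unitfE -unitmxE.
pose q y := std_normal_pdf (affine_map (invmx M) (- (invmx M *m b)) y).
have mq : measurable_fun setT q.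
  apply: measurableT_comp; first exact: measurable_std_normal_pdf.
  exact: measurable_affine_map.
have q0 y : 0 <= q y by exact: std_normal_pdf_ge0.
have mM : measurable (affine_map M b @^-1` A).
  by rewrite -[X in measurable X]setTI; exact: measurable_affine_map.
(* Chosen so that h at M z + b is the indicator of the preimage of A times the standard density at
   z: the inverse map inside q recovers z. *)
pose h y := ((\1_A y)%:E * (q y)%:E)%E.
have mh : measurable_fun setT h.
  by apply: emeasurable_funM; apply/measurable_EFinP.
have h0 y : (0 <= h y)%E by rewrite mule_ge0// lee_fin.
transitivity (\int[lebesgueRn R n]_z h (affine_map M b z))%E.
  transitivity (\int[std_normalRn R n]_z (\1_(affine_map M b @^-1` A) z)%:E)%E.
    by rewrite integral_indic// setIT.
  pose g z := (\1_(affine_map M b @^-1` A) z : R)%:E.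
  have mg : measurable_fun setT g by apply/measurable_EFinP.
  have g0 z : (0 <= g z)%E by rewrite lee_fin.
  rewrite (ge0_integral_std_normalRn mg g0).
  apply: eq_integral => z _; rewrite /h /q affine_map_comp mulVmx// subrr.
  congr (_ * (std_normal_pdf _)%:E)%E.
  by rewrite /affine_map mul1mx addr0 cV_of_tupleK.
under [RHS]eq_integral do rewrite EFinM.
rewrite ge0_integralZl//; first last.
- by move=> y _; rewrite lee_fin; exact: q0.
- by apply/measurable_EFinP; exact: measurable_funTS.
have -> : (\int[lebesgueRn R n]_(y in A) (q y)%:E = \int[lebesgueRn R n]_y h y)%E.
  rewrite integral_mkcond; apply: eq_integral => y _.
  rewrite /h patchE indicE; case: ifP => _; first by rewrite mul1e.
  by rewrite mul0e.
rewrite -(affine_change_of_variables b uM mh h0) muleA -EFinM mulVf// mul1e.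
by [].
Qed.

End standard_normal_law.

(** * Orthogonal invariance *)

Section orthogonal_invariance.
Context (R : realType).
Notation RR := (measurableTypeR R).

Lemma sum_sqr_cV_of_tuple n (t : n.-tuple RR) :
  \sum_(i < n) tnth t i ^+ 2 = ((cV_of_tuple t)^T *m cV_of_tuple t) ord0 ord0.
Proof. by rewrite mxE; apply: eq_bigr => i _; rewrite !mxE. Qed.

Lemma affine_map1 n (t : n.-tuple RR) : affine_map 1%:M 0 t = t.
Proof. by rewrite /affine_map mul1mx addr0 cV_of_tupleK. Qed.

Lemma std_normalRnE n (A : set (n.-tuple RR)) : measurable A ->
  std_normalRn R n A = (\int[lebesgueRn R n]_(y in A) (std_normal_pdf y)%:E)%E.
Proof.
move=> mA; have := std_normalRn_affine (0 : 'cV[R]_n) (unitmx1 R n) mA.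
rewrite det1 normr1 invr1 invmx1 mulmx0 oppr0.
rewrite (_ : affine_map 1%:M 0 = id); last by apply/funext => t; exact: affine_map1.
by rewrite preimage_id => ->; apply: eq_integral => y _; rewrite mul1r.
Qed.

(** U has determinant of modulus 1 and its inverse preserves the norm, so the transformed density is
    the original one. *)
Lemma std_normalRn_orthogonal n (U : 'M[R]_n) (A : set (n.-tuple RR)) :
  U^T *m U = 1%:M -> measurable A ->
  std_normalRn R n (affine_map U 0 @^-1` A) = std_normalRn R n A.
Proof.
move=> UU mA.
have uU : U \in unitmx by case/mulmx1_unit : UU.
have UV : invmx U = U^T by rewrite -[LHS]mul1mx -UU mulmxK.
have detU : `|\det U| = 1.
  apply/eqP; rewrite -sqrp_eq1// -normrX expr2 -{1}det_tr -det_mulmx UU.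
  by rewrite det1 normr1.
rewrite std_normalRn_affine// std_normalRnE// detU invr1.
apply: eq_integral => y _; rewrite mul1r mulmx0 oppr0; congr EFin.
rewrite !std_normal_pdfE !sum_sqr_cV_of_tuple /affine_map addr0 tuple_of_cVK.
by rewrite trmx_mul UV trmxK mulmxA -(mulmxA _ U) -UV mulmxV// mulmx1.
Qed.

Definition coord_tuple m n (f : 'I_n -> 'I_m) (t : m.-tuple RR) : n.-tuple RR :=
  [tuple tnth t (f i) | i < n].

Lemma measurable_coord_tuple m n (f : 'I_n -> 'I_m) : measurable_fun setT (coord_tuple f).
Proof.
apply/measurable_fun_tnthP => i.
rewrite (_ : _ \o _ = fun t : m.-tuple RR => tnth t (f i)); last first.
  by apply/funext => t /=; rewrite tnth_mktuple.
exact: measurable_tnth.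
Qed.

Lemma std_normalRn_tnth n (i : 'I_n) (B : set RR) : measurable B ->
  std_normalRn R n ((fun t : n.-tuple RR => tnth t i) @^-1` B) = normal_prob 0 1 B.
Proof.
move=> mB; pose A j := if j == i then B else setT.
have mA j : measurable (A j) by rewrite /A; case: ifP.
rewrite (_ : _ @^-1` B = [set t : n.-tuple RR | forall j, A j (tnth t j)]).
  rewrite /std_normalRn tuple_measure_box//.
  rewrite (bigD1 i)//= /A eqxx big1 ?mule1// => j /negbTE ->.
  exact: probability_setT.
apply/seteqP; split => t /=; last by move=> /(_ i); rewrite /A eqxx.
by move=> Bt j; rewrite /A; case: eqP => // ->.
Qed.

(** It suffices to compare boxes. The preimage of a box is a box whose sides outside the image of f
    are full and contribute a factor 1; injectivity makes each given side occur exactly once. *)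
Lemma std_normalRn_coord_tuple m n (f : 'I_n -> 'I_m) (B : set (n.-tuple RR)) :
  injective f -> measurable B ->
  std_normalRn R m (coord_tuple f @^-1` B) = std_normalRn R n B.
Proof.
move=> f_inj mB.
have mf := measurable_coord_tuple f.
have -> : std_normalRn R m (coord_tuple f @^-1` B) =
    image_measure (std_normalRn R m) mf B by [].
apply: finite_measure_box_unique => // [|A mA].
  by rewrite /= /pushforward preimage_setT std_normalRnT ltry.
pose A' j := if [pick i | f i == j] is Some i then A i else setT.
have mA' j : measurable (A' j) by rewrite /A'; case: pickP.
have A'f i : A' (f i) = A i.
  rewrite /A'; case: pickP => [k /eqP/f_inj -> //|/(_ i)]; by rewrite eqxx.
have A'N j : j \notin codom f -> A' j = setT.
  rewrite /A'; case: pickP => // i /eqP <-; by rewrite codom_f.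
rewrite /= /pushforward (_ : _ @^-1` box A = [set t : m.-tuple RR | forall j, A' j (tnth t j)]).
  rewrite /std_normalRn tuple_measure_box// tuple_measure_box//.
  rewrite (bigID (mem (codom f)))/= [X in (_ * X)%E]big1 => [|j /A'N ->]; last exact: probability_setT.
  rewrite mule1.
  transitivity (\prod_(j in f @: 'I_n) normal_prob 0 1 (A' j))%E.
    apply: eq_bigl => j; apply/idP/imsetP.
      by move=> /codomP[i ->]; exists i.
    by move=> [i _ ->]; exact: codom_f.
  rewrite big_imset/=; last by move=> i j _ _; exact: f_inj.
  by apply: eq_big => // i _; rewrite A'f.
apply/seteqP; split => t /=.
- move=> h j; have [/codomP[i ->]|/A'N ->//] := boolP (j \in codom f).
  by rewrite A'f; have := h i; rewrite tnth_mktuple.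
- by move=> h i; rewrite tnth_mktuple -A'f; exact: h.
Qed.

(* The Halmos dilation [[0, Q], [Q^T, 1 - Q^T Q]] is a symmetric orthogonal
   matrix, whose first n coordinates are Q applied to the last l ones. *)
Lemma std_normalRn_coisometry n l (Q : 'M[R]_(n, l)) (A : set (n.-tuple RR)) :
  Q *m Q^T = 1%:M -> measurable A ->
  std_normalRn R l (affine_map Q 0 @^-1` A) = std_normalRn R n A.
Proof.
move=> QQ mA.
pose U : 'M[R]_(n + l) := block_mx 0 Q Q^T (1%:M - Q^T *m Q).
have UU : U^T *m U = 1%:M.
  have Q1 : Q *m (1%:M - Q^T *m Q) = 0.
    by rewrite mulmxBr mulmx1 mulmxA QQ mul1mx subrr.
  have Q2 : (1%:M - Q^T *m Q) *m Q^T = 0.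
    by rewrite mulmxBl mul1mx -mulmxA QQ mulmx1 subrr.
  rewrite tr_block_mx trmx0 trmxK linearB/= trmx1 trmx_mul trmxK mulmx_block.
  rewrite !mul0mx !mulmx0 !add0r QQ Q1 Q2 mulmxBl mul1mx -mulmxA Q1 mulmx0 subr0.
  by rewrite addrC subrK -scalar_mx_block.
have mQA : measurable (affine_map Q 0 @^-1` A).
  by rewrite -[X in measurable X]setTI; exact: measurable_affine_map.
(* Both sides are marginals of the standard normal law in dimension n + l, on the last l and the
   first n coordinates respectively, and U preserves that law. *)
rewrite -(std_normalRn_coord_tuple (@rshift_inj n l) mQA).
rewrite -(std_normalRn_coord_tuple (@lshift_inj n l) mA).
rewrite -[RHS](std_normalRn_orthogonal UU); last first.
  by rewrite -[X in measurable X]setTI; exact: measurable_coord_tuple.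
congr (std_normalRn R (n + l) _); apply/seteqP; suff h t :
    affine_map Q 0 (coord_tuple (@rshift n l) t) =
    coord_tuple (@lshift n l) (affine_map U 0 t).
  by split => t /=; rewrite h.
apply: eq_from_tnth => i; rewrite tnth_affine_map [RHS]tnth_mktuple tnth_affine_map.
have zE k (j : 'I_k) : (0 : 'cV[R]_k) j ord0 = 0 by rewrite mxE.
rewrite !zE !addr0.
rewrite [RHS]big_split_ord/= [X in X + _]big1 ?add0r => [|j _]; last first.
  by rewrite /U block_mxEul mxE mul0r.
by apply: eq_bigr => j _; rewrite tnth_mktuple /U block_mxEur.
Qed.

End orthogonal_invariance.

(** * Second moment of the normal law *)

Section normal_second_moment.
Context (R : realType).
Notation mu := (@lebesgue_measure R).

Let g (x : R) : R := expR (- (x ^+ 2 / 2)).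

Let g_ge0 x : 0 <= g x. Proof. exact: expR_ge0. Qed.

Let dg (x : R) : is_derive x 1 (g : R -> R) (- x * g x).
Proof.
have h : is_derive x (1 : R) (fun x : R => - (x ^+ 2 / 2)) (- x).
  by apply: is_derive_eq; rewrite !scaler1 scaler0 scaler0 add0r /GRing.scale/=; field.
have := is_derive1_comp (f := expR) (g := fun x : R => - (x ^+ 2 / 2)).
by move=> /(_ x _ _ _ h); rewrite mulrC; exact.
Qed.

(** Since (x - 1)^2 >= 0 means x^2/2 >= x - 1/2, this function dominates [g], and it has an
    elementary primitive. *)
Let e (x : R) : R := expR (2^-1 - x).

Let de (x : R) : is_derive x 1 (e : R -> R) (- e x).
Proof.
have h : is_derive x (1 : R) (fun x : R => 2^-1 - x) (- 1).
  by apply: is_derive_eq; rewrite scaler0 add0r mul1r.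
have := is_derive1_comp (f := expR) (g := fun x : R => 2^-1 - x).
by move=> /(_ x _ _ _ h); rewrite mulrN1; exact.
Qed.

Let is_derive_continuous (f : R -> R) (df : R -> R) :
  (forall x : R, is_derive x 1 f (df x)) -> continuous f.
Proof.
by move=> h x; apply/differentiable_continuous/derivable1_diffP; case: (h x).
Qed.

Let cg : continuous g. Proof. exact: is_derive_continuous dg. Qed.
Let ce : continuous e. Proof. exact: is_derive_continuous de. Qed.
Let cx2g : continuous (fun x : R => x ^+ 2 * g x).
Proof. by move=> x; apply: cvgM; [exact: exprn_continuous | exact: cg]. Qed.

Let cvg_e : e x @[x --> +oo] --> 0.
Proof.
rewrite (_ : e = fun x => expR 2^-1 * expR (- x)); last first.
  by apply/funext => x; rewrite /e expRD.
rewrite -[X in _ --> X](mulr0 (expR 2^-1)).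
by apply: cvgM; [exact: cvg_cst | exact: cvgr_expR].
Qed.

(** The bound 2/x comes from exp(x^2/2) >= 1 + x^2/2. *)
Let cvg_xg : x * g x @[x --> +oo] --> 0.
Proof.
apply: (@squeeze_cvgr _ _ _ _ (fun=> 0) (fun x : R => 2 * x^-1)).
- near=> x; have x0 : 0 < x by near: x; exact: nbhs_pinfty_gt.
  rewrite mulr_ge0 ?(ltW x0)//= /g expRN ler_pdivrMr ?expR_gt0//.
  have := expR_ge1Dx (x ^+ 2 / 2) => h.
  rewrite mulrAC ler_pdivlMr// -expr2; lra.
- exact: cvg_cst.
- rewrite -[X in _ --> X](mulr0 2); apply: cvgM; first exact: cvg_cst.
  apply/gtr0_cvgV0; last by [].
  by near=> x; near: x; exact: nbhs_pinfty_gt.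
Unshelve. all: by end_near. Qed.

Let FTCy (f F : R -> R) : (forall x, 0 <= x -> 0 <= f x) -> continuous f ->
  (forall x : R, is_derive x 1 F (f x)) -> F x @[x --> +oo] --> 0 ->
  (\int[mu]_(x in `[0%R, +oo[) (f x)%:E = (- F 0)%:E)%E.
Proof.
move=> f0 cf dF F0.
rewrite (@ge0_continuous_FTC2y _ f F 0 0) ?sub0e//.
- exact: continuous_subspaceT.
- exact/cvg_at_right_filter/(is_derive_continuous dF).
- by move=> x _; rewrite derive1E; case: (dF x).
Qed.

(* Both (x^2 - 1) g(x) + e(x) >= 0 and e have explicit primitives vanishing at
   infinity, hence g and x^2 g have the same integral over the half-line. *)
Let integral_x2g :
  (\int[mu]_(x in `[0%R, +oo[) (x ^+ 2 * g x)%:E = \int[mu]_(x in `[0%R, +oo[) (g x)%:E)%E.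
Proof.
pose f (x : R) : R := (x ^+ 2 - 1) * g x + e x.
have g_le_e x : g x <= e x.
  rewrite /g /e ler_expR; have := sqr_ge0 (x - 1); rewrite sqrrB1; lra.
have f0 x : 0 <= f x.
  have := g_le_e x; have : 0 <= x ^+ 2 * g x by rewrite mulr_ge0// sqr_ge0.
  rewrite /f mulrBl mul1r; lra.
have cf : continuous f.
  move=> x; apply: cvgD; last exact: ce.
  apply: cvgM; last exact: cg.
  by apply: cvgB; [exact: exprn_continuous | exact: cvg_cst].
have If : (\int[mu]_(x in `[0%R, +oo[) (f x)%:E = (expR 2^-1)%:E)%E.
  pose F (x : R) : R := - (x * g x) - e x.
  have dF (x : R) : is_derive x 1 (F : R -> R) (f x).
    have dg' := dg x; have de' := de x.
    by apply: is_derive_eq; rewrite /f /GRing.scale/=; ring.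
  have F0 : F x @[x --> +oo] --> 0.
    rewrite -[X in _ --> X](subr0 0); apply: cvgB; last exact: cvg_e.
    by rewrite -[X in _ --> X]oppr0; apply: cvgN; exact: cvg_xg.
  by rewrite (FTCy (fun x _ => f0 x) cf dF F0) /F mul0r oppr0 sub0r opprK /e subr0.
have e0 x : 0 <= e x by exact: expR_ge0.
have Ie : (\int[mu]_(x in `[0%R, +oo[) (e x)%:E = (expR 2^-1)%:E)%E.
  have dF (x : R) : is_derive x 1 ((fun x => - e x) : R -> R) (e x).
    by have de' := de x; apply: is_derive_eq; rewrite opprK.
  have F0 : - e x @[x --> +oo] --> 0.
    by rewrite -[X in _ --> X]oppr0; apply: cvgN; exact: cvg_e.
  by rewrite (FTCy (fun x _ => e0 x) ce dF F0) opprK /e subr0.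
have me (h : R -> R) : continuous h ->
    measurable_fun (`[0%R, +oo[%classic : set (measurableTypeR R)) (EFin \o h).
  by move=> ch; apply/measurable_EFinP/measurable_funTS; exact: continuous_measurable_fun.
(* All four integrands are nonnegative, so additivity needs no integrability; the integrals of e and
   f are equal and finite, hence cancel. *)
have : (\int[mu]_(x in `[0%R, +oo[) (x ^+ 2 * g x)%:E + \int[mu]_(x in `[0%R, +oo[) (e x)%:E =
        \int[mu]_(x in `[0%R, +oo[) (f x)%:E + \int[mu]_(x in `[0%R, +oo[) (g x)%:E)%E.
  rewrite -!ge0_integralD//=; first last.
  - exact: (me e).
  - by move=> x _; rewrite lee_fin.
  - exact: (me (fun x => x ^+ 2 * g x)).
  - by move=> x _; rewrite lee_fin mulr_ge0// sqr_ge0.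
  - exact: (me g).
  - by move=> x _; rewrite lee_fin.
  - exact: (me f).
  - by move=> x _; rewrite lee_fin.
  apply: eq_integral => x _; rewrite -!EFinD; congr EFin; rewrite /f; ring.
rewrite If Ie [RHS]addeC => /(congr1 (fun z => z - (expR 2^-1)%:E)%E).
by rewrite !addeK.
Qed.

(** No Gaussian integral is evaluated: by evenness the second moment and the total mass reduce to
    the half-line, where [integral_x2g] equates them, and the total mass is 1. *)
Lemma integral_sqr_normal_prob :
  (\int[normal_prob 0 1]_x (x ^+ 2)%:E = 1 :> \bar R)%E.
Proof.
etransitivity.
  apply: (@ge0_integral_density _ _ _ (normal_prob 0 1) mu (normal_pdf 0 1)) => //.
  - exact: measurable_normal_pdf.
  - by move=> x; exact: normal_pdf_ge0.
  - by apply/measurable_EFinP; exact: exprn_measurable.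
  - by move=> x; rewrite lee_fin sqr_ge0.
pose c : R := normal_peak 1.
have c0 : 0 <= c by exact: normal_peak_ge0.
have pdfE x : normal_pdf 0 1 x = c * g x.
  rewrite normal_pdfE ?oner_neq0// /c /normal_fun /g subr0 expr1n.
  by rewrite mulNr.
rewrite -(@integral_normal_pdf R 0 1).
have posE : [set x : R | 0 <= x] = `[0, +oo[%classic.
  by apply/seteqP; split => x /=; rewrite in_itv/= andbT.
have half (f : R -> R) : (forall x, 0 <= f x) -> continuous f -> f =1 f \o -%R ->
    (\int[mu]_x (c * f x)%:E = 2%:E * (c%:E * \int[mu]_(x in `[0%R, +oo[) (f x)%:E))%E.
  move=> f0 cf fN; rewrite ge0_symfun_integralT//.
  - rewrite posE; congr *%E; under eq_integral do rewrite EFinM.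
    rewrite ge0_integralZl//.
      by apply/measurable_EFinP/measurable_funTS; exact: continuous_measurable_fun.
    by move=> x _; rewrite lee_fin.
  - by move=> x; rewrite mulr_ge0.
  - by move=> x; apply: cvgM; [exact: cvg_cst | exact: cf].
  - by move=> x /=; rewrite fN.
under eq_integral do rewrite pdfE -EFinM mulrCA.
under [RHS]eq_integral do rewrite pdfE.
rewrite !half ?integral_x2g//.
- by move=> x; rewrite /g /= sqrrN.
- by move=> x; rewrite mulr_ge0// sqr_ge0.
- by move=> x; rewrite /g /= sqrrN.
Qed.

End normal_second_moment.

(** * Moments of linear images of normal vectors *)

Section has_integral.
Context d (T : measurableType d) (R : realType) (mu : {measure set T -> \bar R}).

(** Integrability and a finite value are kept together so that expectations can be computed
    compositionally by linearity. *)
Definition has_integral (f : T -> R) (v : R) : Prop :=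
  mu.-integrable setT (EFin \o f) /\ (\int[mu]_x (f x)%:E = v%:E)%E.

Lemma has_integral_ext f g v : f =1 g -> has_integral f v -> has_integral g v.
Proof. by move=> /funext ->. Qed.

Lemma has_integral_unique f u v : has_integral f u -> has_integral f v -> u = v.
Proof. by move=> [_ fu] [_]; rewrite fu => -[]. Qed.

Lemma has_integralD f g u v : has_integral f u -> has_integral g v ->
  has_integral (fun x => f x + g x) (u + v).
Proof.
move=> [fi fu] [gi gv]; split; first exact: (integrableD measurableT fi gi).
by under eq_integral do rewrite EFinD; rewrite integralD// fu gv.
Qed.

Lemma has_integralZ (c : R) f v : has_integral f v ->
  has_integral (fun x => c * f x) (c * v).
Proof.
move=> [fi fv]; split; first exact: (integrableZl measurableT c fi).
by under eq_integral do rewrite EFinM; rewrite integralZl// fv.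
Qed.

Lemma has_integral0 : has_integral (fun=> 0) 0.
Proof. by split; [exact: integrable0 | rewrite integral0]. Qed.

Lemma has_integral_sum (I : Type) (r : seq I) (f : I -> T -> R) (v : I -> R) :
  (forall i, has_integral (f i) (v i)) ->
  has_integral (fun x => \sum_(i <- r) f i x) (\sum_(i <- r) v i).
Proof.
move=> h; elim: r => [|i r IH].
  rewrite big_nil; apply: has_integral_ext has_integral0 => x.
  by rewrite big_nil.
rewrite big_cons; apply: has_integral_ext (has_integralD (h i) IH) => x.
by rewrite big_cons.
Qed.

Lemma has_integral_cst (c : R) : mu setT = 1%E -> has_integral (fun=> c) c.
Proof.
move=> mu1; split; last by rewrite integral_cst// mu1 mule1.
apply/integrableP; split; first exact/measurable_EFinP/measurable_cst.
change (\int[mu]_x (cst (abse c%:E) x) < +oo)%E.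
by rewrite integral_cst// mu1 mule1 ltry.
Qed.

End has_integral.

Section same_law.
Context d0 d1 d2 (T0 : measurableType d0) (T1 : measurableType d1)
  (T2 : measurableType d2) (R : realType).
Variables (m0 : {measure set T0 -> \bar R}) (m1 : {measure set T1 -> \bar R}).
Variables (X : T0 -> T2) (Y : T1 -> T2).
Hypotheses (mX : measurable_fun setT X) (mY : measurable_fun setT Y).
Hypothesis XY : forall B, measurable B -> m0 (X @^-1` B) = m1 (Y @^-1` B).

Lemma has_integral_same_law (h : T2 -> R) (v : R) : measurable_fun setT h ->
  has_integral m1 (h \o Y) v -> has_integral m0 (h \o X) v.
Proof.
move=> mh [hi hv].
have mhE : measurable_fun setT (EFin \o h) by apply/measurable_EFinP.
(* The nonnegative case, applied to the absolute value of h, transfers integrability before the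
   signed integral is compared. *)
have ge0_XY (k : T2 -> \bar R) : measurable_fun setT k -> (forall y, 0 <= k y)%E ->
    (\int[m0]_x k (X x) = \int[m1]_x k (Y x))%E.
  move=> mk k0.
  rewrite -[LHS](@ge0_integral_pushforward _ _ _ _ _ _ mX m0 setT k)//.
  rewrite -[RHS](@ge0_integral_pushforward _ _ _ _ _ _ mY m1 setT k)//.
  by apply: (eq_measure_integral (image_measure m1 mY) (m1 := image_measure m0 mX)) => B mB _; exact: XY.
have hXi : m0.-integrable setT (EFin \o (h \o X)).
  apply/integrableP; split; first exact: (measurableT_comp mhE mX).
  rewrite (ge0_XY (abse \o (EFin \o h)))//.
  - by case/integrableP : hi.
  - exact: measurableT_comp.
  - by move=> y; exact: abse_ge0.
split => //.
rewrite -[LHS](@integral_pushforward _ _ _ _ _ _ mX m0 setT (EFin \o h))//.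
rewrite -hv -[RHS](@integral_pushforward _ _ _ _ _ _ mY m1 setT (EFin \o h))//.
by apply: (eq_measure_integral (image_measure m1 mY) (m1 := image_measure m0 mX)) => B mB _; exact: XY.
Qed.

End same_law.

Section normal_moments.
Context (R : realType).
Notation RR := (measurableTypeR R).

Let mtnth n (i : 'I_n) : measurable_fun setT (fun t : n.-tuple RR => tnth t i : R).
Proof. exact: measurable_tnth. Qed.

Lemma std_normal_sqr n (i : 'I_n) :
  has_integral (std_normalRn R n) (fun t => tnth t i ^+ 2) 1.
Proof.
apply: (@has_integral_same_law _ _ _ _ _ RR R _ (normal_prob 0 1) (fun t => tnth t i) id _ _ _
  (fun x => x ^+ 2)).
- exact: mtnth.
- by [].
- by move=> B mB; exact: std_normalRn_tnth.
- exact: exprn_measurable.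
split; last by rewrite integral_sqr_normal_prob.
apply/integrableP; split; first by apply/measurable_EFinP; exact: exprn_measurable.
under eq_integral do rewrite /= ger0_norm ?sqr_ge0//.
by rewrite integral_sqr_normal_prob ltry.
Qed.

(** As U preserves the law, the integral equals its own opposite; integrability makes it finite,
    hence 0. *)
Lemma std_normal_odd n (U : 'M[R]_n) (h : n.-tuple RR -> R) :
  U^T *m U = 1%:M -> measurable_fun setT h ->
  (std_normalRn R n).-integrable setT (EFin \o h) ->
  (forall t, h (affine_map U 0 t) = - h t) ->
  has_integral (std_normalRn R n) h 0.
Proof.
move=> UU mh hi hN.
have [v hv] : exists v, has_integral (std_normalRn R n) h v.
  exists (fine (\int[std_normalRn R n]_t (h t)%:E)); split => //.
  by rewrite fineK//; exact: integrable_fin_num.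
have h1 : has_integral (std_normalRn R n) (h \o affine_map U 0) v.
  apply: (has_integral_same_law (Y := id) _ _ _ mh hv) => //.
  - exact: measurable_affine_map.
  - by move=> B mB; exact: std_normalRn_orthogonal.
have h2 : has_integral (std_normalRn R n) (h \o affine_map U 0) (- v).
  rewrite -mulN1r; apply: has_integral_ext (has_integralZ (-1) hv) => t /=.
  by rewrite hN mulN1r.
have := has_integral_unique h1 h2 => vN.
suff -> : 0 = v by [].
lra.
Qed.

Definition reflection n (i : 'I_n) : 'M[R]_n := diag_mx (\row_j (-1) ^+ (j == i)).

Lemma reflection_orthogonal n (i : 'I_n) : (reflection i)^T *m reflection i = 1%:M.
Proof.
rewrite tr_diag_mx mulmx_diag -diag_const_mx; congr diag_mx; apply/rowP => j.
by rewrite !mxE -expr2 sqrr_sign.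
Qed.

Lemma tnth_reflection n (i j : 'I_n) t :
  tnth (affine_map (reflection i) 0 t) j = (-1) ^+ (j == i) * tnth t j :> R.
Proof.
rewrite tnth_affine_map mxE addr0 (bigD1 j)//= big1 ?addr0 => [|k kj].
  by rewrite !mxE eqxx mulr1n.
by rewrite !mxE [j == k]eq_sym (negbTE kj) mulr0n mul0r.
Qed.

Lemma std_normal_mean n (i : 'I_n) :
  has_integral (std_normalRn R n) (fun t => tnth t i) 0.
Proof.
apply: (std_normal_odd (reflection_orthogonal i)); first exact: mtnth.
(* Integrability follows from the bound |x| <= 1 + x^2. *)
- have [h _] := has_integralD (has_integral_cst 1 (std_normalRnT R n)) (std_normal_sqr i).
  apply: (le_integrable measurableT _ _ h).
    by apply/measurable_EFinP; exact: mtnth.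
  move=> t _ /=; rewrite lee_fin [leRHS]ger0_norm ?addr_ge0 ?sqr_ge0//.
  set x := tnth t i; rewrite -(real_normK (num_real x)).
  have := sqr_ge0 (`|x| - 1); rewrite sqrrB1; have := normr_ge0 x; lra.
- by move=> t; rewrite tnth_reflection eqxx expr1 mulN1r.
Qed.

Lemma std_normal_cov n (i j : 'I_n) :
  has_integral (std_normalRn R n) (fun t => tnth t i * tnth t j) (i == j)%:R.
Proof.
have [<-|ij] := eqVneq i j.
  by apply: has_integral_ext (std_normal_sqr i) => t; rewrite expr2.
(* Flipping the sign of the i-th coordinate alone reverses the product; it is integrable because |x
   y| <= x^2 + y^2. *)
apply: (std_normal_odd (reflection_orthogonal i)).
- by apply: measurable_funM; exact: mtnth.
- have [h _] := has_integralD (std_normal_sqr i) (std_normal_sqr j).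
  apply: (le_integrable measurableT _ _ h).
    by apply/measurable_EFinP/measurable_funM; exact: mtnth.
  move=> t _ /=; rewrite lee_fin [leRHS]ger0_norm ?addr_ge0 ?sqr_ge0// normrM.
  set x := tnth t i; set y := tnth t j.
  rewrite -(real_normK (num_real x)) -(real_normK (num_real y)).
  have := sqr_ge0 (`|x| - `|y|); rewrite sqrrB.
  have := mulr_ge0 (normr_ge0 x) (normr_ge0 y); lra.
- move=> t; rewrite !tnth_reflection eqxx eq_sym (negbTE ij).
  by rewrite expr1 expr0 mul1r mulN1r mulNr.
Qed.

Lemma affine_normal_mean n l (A : 'M[R]_(n, l)) (m : 'cV[R]_n) i :
  has_integral (std_normalRn R l) (fun t => tnth (affine_map A m t) i) (m i ord0).
Proof.
rewrite -[m i ord0]add0r.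
have h := has_integralD (has_integral_sum (index_enum 'I_l)
    (fun j => has_integralZ (A i j) (std_normal_mean j)))
  (has_integral_cst (m i ord0) (std_normalRnT R l)).
rewrite [X in X + _]big1 in h; last by move=> j _; rewrite mulr0.
by apply: has_integral_ext h => t; rewrite tnth_affine_map.
Qed.

Lemma linear_normal_cov n l (A : 'M[R]_(n, l)) i j :
  has_integral (std_normalRn R l)
    (fun t => tnth (affine_map A 0 t) i * tnth (affine_map A 0 t) j)
    ((A *m A^T) i j).
Proof.
have h := has_integral_sum (index_enum 'I_l) (fun k =>
  has_integral_sum (index_enum 'I_l) (fun k' =>
    has_integralZ (A i k * A j k') (std_normal_cov k k'))).
have -> : (A *m A^T) i j = \sum_k \sum_k' A i k * A j k' * (k == k')%:R.
  rewrite mxE; apply: eq_bigr => k _; rewrite (bigD1 k)//= eqxx mulr1 mxE.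
  by rewrite big1 ?addr0// => k' k'k; rewrite eq_sym (negbTE k'k) mulr0.
apply: has_integral_ext h => t.
rewrite !tnth_affine_map !mxE !addr0 big_distrlr/=.
by apply: eq_bigr => k _; apply: eq_bigr => k' _; rewrite mulrACA.
Qed.

End normal_moments.

(** * Entropy of a nondegenerate normal vector *)

Section normal_entropy.
Context (R : realType) d (T : measurableType d) (P : probability T R).
Notation RR := (measurableTypeR R).

Lemma ln_normal_peak1 : ln (normal_peak (1 : R)) = - (ln (2 * pi) / 2).
Proof.
rewrite /normal_peak expr1n mul1r lnV ?posrE ?sqrtr_gt0; last first.
  by rewrite -mulr_natr mulr_gt0// pi_gt0.
rewrite -[pi *+ 2]mulr_natl; congr (- _).
have p2 : 0 < 2 * pi :> R by rewrite mulr_gt0// pi_gt0.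
rewrite -[in RHS](sqr_sqrtr (ltW p2)) lnXn ?sqrtr_gt0// mulr2n; by field.
Qed.

(** The entropy is minus the expectation of ln f(X). At X = W z, ln f is a constant minus half the
    squared norm of z, and that squared norm has expectation n. *)
Lemma differential_entropy_normal n (X : {RV P >-> n.-tuple RR}) (W : 'M[R]_n) :
  W \in unitmx ->
  (forall B, measurable B ->
    distribution P X B = std_normalRn R n (affine_map W 0 @^-1` B)) ->
  differential_entropy X =
  (ln `|\det W| + n%:R / 2 * (1 + ln (2 * pi)))%:E.
Proof.
move=> uW XW.
have detW0 : 0 < `|\det W| by rewrite normr_gt0 -unitfE -unitmxE.
pose f y := `|\det W|^-1 * std_normal_pdf (affine_map (invmx W) (- (invmx W *m 0)) y).
have fE y : f y = `|\det W|^-1 * (normal_peak 1 ^+ n *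
    expR (- (\sum_(i < n) tnth (affine_map (invmx W) (- (invmx W *m 0)) y) i ^+ 2) / 2)).
  by rewrite /f std_normal_pdfE.
have peak0 : 0 < normal_peak 1 :> R by rewrite normal_peak_gt0 ?oner_neq0.
have f0 y : 0 < f y.
  by rewrite fE mulr_gt0 ?invr_gt0// mulr_gt0 ?exprn_gt0// expR_gt0.
have mf : measurable_fun setT f.
  apply: measurable_funM; first exact: measurable_cst.
  by apply: measurableT_comp; [exact: measurable_std_normal_pdf | exact: measurable_affine_map].
have mlnf : measurable_fun setT (@ln R \o f) by apply: measurableT_comp; first exact: measurable_ln.
have fX A : measurable A -> distribution P X A = (\int[lebesgueRn R n]_(y in A) (f y)%:E)%E.
  by move=> mA; rewrite XW// std_normalRn_affine.
have dom := density_dominates mf fX.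
have fRN := ae_eq_density_Radon_Nikodym mf (fun y => ltW (f0 y)) fX.
pose v := - ln `|\det W| - n%:R * (ln (2 * pi) / 2) - n%:R / 2.
have hv : has_integral (distribution P X) (@ln R \o f) v.
  apply: (@has_integral_same_law _ _ _ _ _ _ R (distribution P X) (std_normalRn R n)
    id (affine_map W 0) _ _ _ (@ln R \o f)) => //.
    exact: measurable_affine_map.
  have h := has_integralD
    (has_integral_cst (- ln `|\det W| - n%:R * (ln (2 * pi) / 2)) (std_normalRnT R n))
    (has_integralZ (- 2^-1) (has_integral_sum (index_enum 'I_n) (@std_normal_sqr R n))).
  rewrite sumr_const card_ord in h.
  have -> : v = - ln `|\det W| - n%:R * (ln (2 * pi) / 2) + - 2^-1 * n%:R.
    by rewrite /v mulNr [_ / 2]mulrC.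
  apply: has_integral_ext h => t /=.
  rewrite fE affine_map_comp mulVmx// subrr affine_map1.
  rewrite [RHS]lnM ?posrE ?invr_gt0 ?mulr_gt0 ?exprn_gt0 ?expR_gt0// lnV ?posrE//.
  rewrite [ln (_ ^+ _ * _)]lnM ?posrE ?exprn_gt0 ?expR_gt0//.
  rewrite lnXn// ln_normal_peak1 expRK -mulr_natl; ring.
(* The density rules out the [-oo] branch. In the other one the Radon-Nikodym derivative is only
   almost everywhere equal to f, which is enough under the integral. *)
rewrite /differential_entropy; case: pselect => [dom'|/(_ dom)//].
rewrite (_ : (\int[_]_z _ = v%:E)%E); last first.
  rewrite -hv.2 -(Radon_Nikodym_change_of_variables dom measurableT hv.1).
  have mRN : measurable_fun setT
      (Radon_Nikodym (charge_of_finite_measure (distribution P X)) (lebesgueRn R n)).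
    exact/measurable_int/Radon_Nikodym_integrable.
  apply: ae_eq_integral => //.
  - apply/measurable_EFinP; apply: measurable_funM; first exact: measurableT_comp.
    by apply: measurableT_comp; [exact: measurable_ln | exact: measurableT_comp].
  - by apply: emeasurable_funM => //; exact/measurable_EFinP.
  - apply: filterS fRN => y fy _; rewrite -fy//=.
    by rewrite -EFinM mulrC.
by rewrite /v -EFinN; congr EFin; field.
Qed.

End normal_entropy.

(** * Real form of a complex matrix *)

Section real_form.
Context (R : realType).
Local Notation I := (0 +i* 1 : R[i]).
Local Notation toC := (map_mx (real_complex R)).

Lemma conj_real_complex (x : R) : Num.conj (x%:C) = x%:C.
Proof. by rewrite conj_Creal// complex_real. Qed.

Lemma conj_I : Num.conj I = - I.
Proof. by apply/eqP; rewrite eq_complex/= oppr0 !eqxx. Qed.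

Lemma sqrI : I * I = -1.
Proof. by rewrite -expr2 sqr_i. Qed.

Lemma re_im_mxE m n (M : 'M[R[i]]_(m, n)) :
  M = toC (map_mx (@complex.Re R) M) + I *: toC (map_mx (@complex.Im R) M).
Proof. by apply/matrixP => i j; rewrite !mxE [LHS]complexE. Qed.

Lemma re_im_mx_inj m n (A B A' B' : 'M[R]_(m, n)) :
  toC A + I *: toC B = toC A' + I *: toC B' -> A = A' /\ B = B'.
Proof.
move=> /matrixP h; have hij i j : A i j = A' i j /\ B i j = B' i j.
  have := h i j; rewrite !mxE => /eqP; rewrite eq_complex/=.
  by move=> /andP[/eqP h1 /eqP h2]; split; lra.
by split; apply/matrixP => i j; case: (hij i j).
Qed.

Lemma conj_re_im_mx m n (A B : 'M[R]_(m, n)) :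
  map_mx Num.conj (toC A + I *: toC B) = toC A - I *: toC B.
Proof.
apply/matrixP => i j.
by rewrite !mxE rmorphD rmorphM/= !conj_real_complex conj_I mulNr.
Qed.

(** Multiplication by D seen as a real linear map, in the coordinates of [stack]. *)
Definition real_form p (D : 'M[R[i]]_p) : 'M[R]_(p + p) :=
  block_mx (map_mx (@complex.Re R) D) (- map_mx (@complex.Im R) D)
           (map_mx (@complex.Im R) D) (map_mx (@complex.Re R) D).

(** Sends the stacked real vector back to the complex one, so that complex second-order statistics
    become congruences of a real matrix. *)
Definition unstack_mx p : 'M[R[i]]_(p, p + p) := row_mx 1%:M I%:M.

Lemma mul_unstack_real_form p (D : 'M[R[i]]_p) :
  unstack_mx p *m toC (real_form D) = D *m unstack_mx p.
Proof.
rewrite /real_form /unstack_mx map_block_mx mul_row_block mul_mx_row mulmx1 !mul1mx.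
rewrite !mul_scalar_mx mul_mx_scalar -re_im_mxE; congr row_mx.
rewrite {3}[D]re_im_mxE scalerDr scalerA sqrI scaleN1r addrC; congr (_ + _).
by apply/matrixP => i j; rewrite !mxE rmorphN.
Qed.

(** For G the second-moment matrix of a centred stacked vector this is the covariance, and
    [unstack_mx_tr] is the pseudo-covariance. Sums and differences of blocks appear in complementary
    ways, so the two together recover G. *)
Lemma unstack_mx_herm p (G : 'M[R]_(p + p)) :
  unstack_mx p *m toC G *m hermitian_transpose (unstack_mx p) =
  toC (ulsubmx G + drsubmx G) + I *: toC (dlsubmx G - ursubmx G).
Proof.
rewrite -{1}[G]submxK /unstack_mx map_block_mx /hermitian_transpose map_row_mx tr_row_mx.
rewrite mul_row_block mul_row_col !mul1mx.
rewrite !map_scalar_mx/= conj_I rmorph1 !tr_scalar_mx mulmx1 !mul_scalar_mx mul_mx_scalar.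
rewrite scalerDr scalerA mulNr sqrI opprK scale1r scaleNr.
by rewrite !map_mxD map_mxN/= scalerBr [X in _ + X]addrC addrACA.
Qed.

Lemma unstack_mx_tr p (G : 'M[R]_(p + p)) :
  unstack_mx p *m toC G *m (unstack_mx p)^T =
  toC (ulsubmx G - drsubmx G) + I *: toC (dlsubmx G + ursubmx G).
Proof.
rewrite -{1}[G]submxK /unstack_mx map_block_mx tr_row_mx.
rewrite mul_row_block mul_row_col !mul1mx !tr_scalar_mx mulmx1 !mul_scalar_mx mul_mx_scalar.
rewrite scalerDr scalerA sqrI scaleN1r.
by rewrite !map_mxD map_mxN/= scalerDr [X in _ + X]addrC addrACA.
Qed.

Lemma det_conj p (D : 'M[R[i]]_p) : \det (map_mx Num.conj D) = Num.conj (\det D).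
Proof. exact: det_map_mx. Qed.

(* [[1, i], [1, -i]] conjugates the real form to diag(D, conj D). *)
Lemma det_real_form p (D : 'M[R[i]]_p) :
  (\det (real_form D))%:C = \det D * Num.conj (\det D).
Proof.
pose S : 'M[R[i]]_(p + p) := block_mx 1%:M I%:M 1%:M (- I)%:M.
pose S' : 'M[R[i]]_(p + p) := block_mx 1%:M 1%:M (- I)%:M I%:M.
have SS' : S *m (2^-1 *: S') = 1%:M.
  rewrite -scalemxAr /S /S' mulmx_block !mul1mx -!scalar_mxM mulrN mulNr sqrI opprK mulNr mulrN sqrI.
  have h2 : 1%:M + 1%:M = 2%:M :> 'M[R[i]]_p by rewrite -raddfD.
  have h0 : 1%:M + (- 1)%:M = 0 :> 'M[R[i]]_p by rewrite -raddfD/= subrr raddf0.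
  rewrite !opprK h2 h0 scale_block_mx !scaler0 scale_scalar_mx mulVf ?pnatr_eq0//.
  by rewrite -scalar_mx_block.
have uS : \det S != 0 by have [+ _] := mulmx1_unit SS'; rewrite unitmxE unitfE.
have SF : S *m toC (real_form D) = block_mx D 0 0 (map_mx Num.conj D) *m S.
  rewrite /S /real_form map_block_mx !mulmx_block !mul1mx !mul0mx !mulmx1 !addr0 !add0r.
  rewrite !mul_scalar_mx !mul_mx_scalar map_mxN/= scaleNr.
  have cD := conj_re_im_mx (map_mx (@complex.Re R) D) (map_mx (@complex.Im R) D).
  rewrite -re_im_mxE in cD; rewrite cD -re_im_mxE; congr block_mx.
  - rewrite {3}[D]re_im_mxE scalerDr scalerA sqrI scaleN1r addrC; congr (_ + _).
  - by rewrite scalerBr scaleNr scalerA mulNr sqrI opprK scale1r addrC.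
have := congr1 determinant SF; rewrite !det_mulmx det_ublock det_conj det_map_mx.
rewrite [RHS]mulrC => /(mulfI uS); exact.
Qed.

End real_form.

(** * Whitening *)

Section whitening.
Context (R : realType).
Local Notation I := (0 +i* 1 : R[i]).
Local Notation toC := (map_mx (real_complex R)).

(* The second-order statistics D J G J^H D^H = 1 and D J G J^T D^T = diag lambda
   determine all four blocks of F G F^T, for F the real form of D. *)
Lemma real_form_diagonalizes p (D : 'M[R[i]]_p) (G : 'M[R]_(p + p)) (lambda : 'rV[R]_p) :
  D *m (unstack_mx R p *m toC G *m hermitian_transpose (unstack_mx R p)) *m
    hermitian_transpose D = 1%:M ->
  D *m (unstack_mx R p *m toC G *m (unstack_mx R p)^T) *m D^T =
    diag_mx (toC lambda) ->
  real_form D *m G *m (real_form D)^T =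
  diag_mx (row_mx (\row_k ((1 + lambda ord0 k) / 2)) (\row_k ((1 - lambda ord0 k) / 2))).
Proof.
set F := real_form D; set J := unstack_mx R p; set H := F *m G *m F^T => h1 h2.
have DJ : D *m J = J *m toC F by rewrite mul_unstack_real_form.
have toCF : map_mx Num.conj (toC F) = toC F.
  by apply/matrixP => i j; rewrite !mxE conj_real_complex.
have hermDJ : hermitian_transpose J *m hermitian_transpose D = toC F^T *m hermitian_transpose J.
  rewrite /hermitian_transpose -!trmx_mul -!map_mxM DJ map_mxM toCF trmx_mul.
  by congr (_ *m _); rewrite map_trmx.
have {}h1 : J *m toC H *m hermitian_transpose J = toC 1%:M + I *: toC 0.
  rewrite map_mx1 map_mx0 scaler0 addr0 -h1 /H !map_mxM !mulmxA -DJ -!mulmxA.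
  by rewrite -hermDJ !mulmxA.
have {}h2 : J *m toC H *m J^T = toC (diag_mx lambda) + I *: toC 0.
  rewrite map_mx0 scaler0 addr0 map_diag_mx -h2 /H !map_mxM !mulmxA -DJ -!mulmxA.
  by rewrite -map_trmx -!trmx_mul -DJ !mulmxA.
move: h1 h2; rewrite unstack_mx_herm unstack_mx_tr.
move=> /re_im_mx_inj[a1 a2] /re_im_mx_inj[b1 b2].
(* The diagonal blocks have sum 1 and difference diag(lambda); the off-diagonal blocks have zero sum
   and zero difference. *)
clearbody H; rewrite -[H]submxK diag_mx_row; congr block_mx; apply/matrixP => i j.
- have := congr1 (fun M : 'M[R]_p => M i j) a1; have := congr1 (fun M : 'M[R]_p => M i j) b1.
  rewrite !mxE; case: eqVneq => [->|_]; rewrite ?mulr1n ?mulr0n; lra.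
- have := congr1 (fun M : 'M[R]_p => M i j) a2; have := congr1 (fun M : 'M[R]_p => M i j) b2.
  rewrite !mxE; lra.
- have := congr1 (fun M : 'M[R]_p => M i j) a2; have := congr1 (fun M : 'M[R]_p => M i j) b2.
  rewrite !mxE; lra.
- have := congr1 (fun M : 'M[R]_p => M i j) a1; have := congr1 (fun M : 'M[R]_p => M i j) b1.
  rewrite !mxE; case: eqVneq => [->|_]; rewrite ?mulr1n ?mulr0n; lra.
Qed.

Lemma gram_diag_ge0 n l (A : 'M[R]_(n, l)) i : 0 <= (A *m A^T) i i.
Proof. by rewrite mxE sumr_ge0// => j _; rewrite mxE -expr2 sqr_ge0. Qed.

Lemma ln_prod n (f : 'I_n -> R) : (forall i, 0 < f i) ->
  ln (\prod_i f i) = \sum_i ln (f i).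
Proof.
move=> f0; rewrite -[RHS]expRK expR_sum; congr ln.
by apply: eq_bigr => i _; rewrite lnK ?posrE.
Qed.

Lemma gram_sqrt_diag n l (A : 'M[R]_(n, l)) (F : 'M[R]_n) (delta : 'rV[R]_n) :
  F \in unitmx -> F *m (A *m A^T) *m F^T = diag_mx delta ->
  (forall i, 0 < delta ord0 i) ->
  exists W : 'M[R]_n, [/\ W \in unitmx, W *m W^T = A *m A^T &
    ln `|\det W| = 2^-1 * \sum_i ln (delta ord0 i) - ln `|\det F| ].
Proof.
move=> uF FAF d0.
pose S := diag_mx (\row_i Num.sqrt (delta ord0 i)).
have SS : S *m S^T = diag_mx delta.
  rewrite tr_diag_mx mulmx_diag; congr diag_mx; apply/rowP => i.
  by rewrite !mxE -expr2 sqr_sqrtr// ltW.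
have detS : \det S = \prod_i Num.sqrt (delta ord0 i).
  by rewrite det_diag; apply: eq_bigr => i _; rewrite mxE.
have detS0 : 0 < \det S by rewrite detS prodr_gt0// => i _; rewrite sqrtr_gt0.
have uS : S \in unitmx by rewrite unitmxE unitfE gt_eqF.
exists (invmx F *m S); split.
- by rewrite unitmx_mul unitmx_inv uF uS.
- rewrite trmx_mul mulmxA -(mulmxA _ S) SS -FAF trmx_inv.
  by rewrite !mulmxA mulVmx// mul1mx -!mulmxA mulmxV ?unitmx_tr// mulmx1.
- have detF0 : 0 < `|\det F| by rewrite normr_gt0 -unitfE -unitmxE.
  rewrite det_mulmx det_inv normrM normfV (gtr0_norm detS0).
  rewrite lnM ?posrE ?invr_gt0// lnV ?posrE// addrC; congr (_ - _).
  rewrite detS ln_prod => [|i]; last by rewrite sqrtr_gt0.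
  rewrite mulr_sumr; apply: eq_bigr => i _.
  rewrite -[in RHS](sqr_sqrtr (ltW (d0 i))) lnXn ?sqrtr_gt0// mulr2n; by field.
Qed.

End whitening.

(** * Complex expectations *)

Section complex_expectation.
Context (R : realType) d (T : measurableType d) (P : probability T R).
Local Notation I := (0 +i* 1 : R[i]).
Local Notation toC := (map_mx (real_complex R)).

Definition has_cintegral (F : T -> R[i]) (z : R[i]) : Prop :=
  has_integral P (fun w => complex.Re (F w)) (complex.Re z) /\
  has_integral P (fun w => complex.Im (F w)) (complex.Im z).

Lemma has_cintegral_real (f : T -> R) (v : R) :
  has_integral P f v -> has_cintegral (fun w => (f w)%:C) v%:C.
Proof. by move=> fv; split => //=; exact: has_integral0. Qed.

Lemma has_cintegralZ (c : R[i]) F z : has_cintegral F z ->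
  has_cintegral (fun w => c * F w) (c * z).
Proof.
case: c => a b [hr hi]; split; case: z hr hi => u v /= hr hi.
- have h := has_integralD (has_integralZ a hr) (has_integralZ (- b) hi).
  rewrite mulNr in h; apply: has_integral_ext h => w.
  by case: (F w) => x y /=; rewrite mulNr.
- have h := has_integralD (has_integralZ a hi) (has_integralZ b hr).
  by apply: has_integral_ext h => w; case: (F w).
Qed.

Lemma has_cintegral_sum (J : Type) (r : seq J) (F : J -> T -> R[i]) (z : J -> R[i]) :
  (forall i, has_cintegral (F i) (z i)) ->
  has_cintegral (fun w => \sum_(i <- r) F i w) (\sum_(i <- r) z i).
Proof.
move=> h; elim: r => [|i r [IHr IHi]].
  rewrite big_nil; split; apply: has_integral_ext (has_integral0 P) => w; by rewrite big_nil.
rewrite big_cons; have [hr hi] := h i; split.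
- have -> : complex.Re (z i + \sum_(j <- r) z j) = complex.Re (z i) + complex.Re (\sum_(j <- r) z j).
    by case: (z i) => ? ?; case: (\sum_(j <- r) _).
  apply: has_integral_ext (has_integralD hr IHr) => w; rewrite big_cons.
  by case: (F i w) => ? ?; case: (\sum_(j <- r) _).
- have -> : complex.Im (z i + \sum_(j <- r) z j) = complex.Im (z i) + complex.Im (\sum_(j <- r) z j).
    by case: (z i) => ? ?; case: (\sum_(j <- r) _).
  apply: has_integral_ext (has_integralD hi IHi) => w; rewrite big_cons.
  by case: (F i w) => ? ?; case: (\sum_(j <- r) _).
Qed.

Lemma cexpectationE m n (Y : T -> 'M[R[i]]_(m, n)) (V : 'M[R[i]]_(m, n)) :
  (forall i j, has_cintegral (fun w => Y w i j) (V i j)) -> cexpectation P Y = V.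
Proof.
move=> h; apply/matrixP => i j; have [[_ hr] [_ hi]] := h i j.
rewrite mxE unlock hr hi /=; by case: (V i j).
Qed.

(** All complex moments needed are of this shape, a real random matrix between complex constants, so
    they reduce to real integrals. *)
Lemma cexpectation_mulmx q m n r (K : 'M[R[i]]_(q, m)) (L : 'M[R[i]]_(n, r))
    (Z : T -> 'M[R]_(m, n)) (V : 'M[R]_(m, n)) :
  (forall i j, has_integral P (fun w => Z w i j) (V i j)) ->
  cexpectation P (fun w => K *m toC (Z w) *m L) = K *m toC V *m L.
Proof.
move=> h; apply: cexpectationE => i j.
have E (M : 'M[R]_(m, n)) : (K *m toC M *m L) i j =
    \sum_b \sum_a (L b j * K i a) * (M a b)%:C.
  rewrite mxE; apply: eq_bigr => b _; rewrite mxE mulr_suml; apply: eq_bigr => a _.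
  by rewrite mxE mulrAC [K i a * _]mulrC.
rewrite E.
rewrite (_ : (fun w => _) = fun w => \sum_b \sum_a (L b j * K i a) * (Z w a b)%:C); last first.
  by apply/funext => w; exact: E.
apply: has_cintegral_sum => b; apply: has_cintegral_sum => a.
exact/has_cintegralZ/has_cintegral_real.
Qed.

Section second_order.
Variables (N : nat) (X : T -> 'cV[R]_N) (G : 'M[R]_N).
Hypothesis X_mean : forall i, has_integral P (fun w => X w i ord0) 0.
Hypothesis X_cov : forall i j, has_integral P (fun w => X w i ord0 * X w j ord0) (G i j).

Let mean0 q (K : 'M[R[i]]_(q, N)) : cexpectation P (fun w => K *m toC (X w)) = 0.
Proof.
transitivity (K *m toC (0 : 'cV[R]_N) *m 1%:M); last by rewrite map_mx0 mulmx0 mul0mx.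
rewrite -(@cexpectation_mulmx _ _ _ _ K 1%:M X) => [|i j].
  by congr cexpectation; apply/funext => w; rewrite mulmx1.
by rewrite mxE (ord1 j); exact: X_mean.
Qed.

Let XX_cov i j : has_integral P (fun w => (X w *m (X w)^T) i j) (G i j).
Proof.
by apply: has_integral_ext (X_cov i j) => w; rewrite mxE big_ord1 mxE.
Qed.

Lemma cov_mulmx q (K : 'M[R[i]]_(q, N)) :
  cov P (fun w => K *m toC (X w)) = K *m toC G *m hermitian_transpose K.
Proof.
rewrite /cov mean0 -(cexpectation_mulmx _ _ XX_cov); congr cexpectation.
apply/funext => w; rewrite subr0 /hermitian_transpose !map_mxM/= trmx_mul !mulmxA.
congr (_ *m _ *m _); rewrite -map_trmx; congr trmx.
by apply/matrixP => i j; rewrite !mxE conj_real_complex.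
Qed.

Lemma pcov_mulmx q (K : 'M[R[i]]_(q, N)) :
  pcov P (fun w => K *m toC (X w)) = K *m toC G *m K^T.
Proof.
rewrite /pcov mean0 -(cexpectation_mulmx _ _ XX_cov); congr cexpectation.
apply/funext => w; rewrite subr0 !map_mxM/= trmx_mul !mulmxA.
by congr (_ *m _ *m _); rewrite -map_trmx.
Qed.

End second_order.

Lemma cvectE p (x : complexRV P p) w :
  cvect x w = unstack_mx R p *m toC (cV_of_tuple (stack x w)).
Proof.
have -> : toC (cV_of_tuple (stack x w)) =
    col_mx (\col_k (tnth (re_part x w) k)%:C) (\col_k (tnth (im_part x w) k)%:C).
  apply/colP => i; rewrite !mxE; case: (split_ordP i) => j ->.
  - by rewrite tnth_lshift mxE.
  - by rewrite tnth_rshift mxE.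
rewrite /unstack_mx mul_row_col mul1mx mul_scalar_mx; apply/colP => k.
by rewrite !mxE [LHS]complexE.
Qed.

End complex_expectation.

(** * Main result *)

Section circularity.
Context (R : realType).
Local Notation toC := (map_mx (real_complex R)).

Lemma unstack_mx_mulmx p (v : 'cV[R]_(p + p)) :
  unstack_mx R p *m toC v = toC (usubmx v) + (0 +i* 1) *: toC (dsubmx v).
Proof.
rewrite -{1}[v]vsubmxK map_col_mx /unstack_mx mul_row_col mul1mx.
by rewrite mul_scalar_mx.
Qed.

(** The bounds on x keep both factors of 1 - x^2 positive, as splitting the logarithm requires. *)
Lemma ln_circularity_pair (x : R) : 0 <= x < 1 ->
  ln ((1 + x) / 2) + ln ((1 - x) / 2) = ln (1 - x ^+ 2) - 2 * ln 2.
Proof.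
move=> /andP[x0 x1]; have x1' : 0 < 1 - x by lra.
have x0' : 0 < 1 + x by lra.
have -> : 1 - x ^+ 2 = (1 - x) * (1 + x) by ring.
rewrite !ln_div ?posrE// lnM ?posrE//; ring.
Qed.

End circularity.

Unset Implicit Arguments.

(* The covariance matrix is Hermitian, so its determinant is real. *)
Theorem corollary2 (R : realType) (d : measure_display) (T : measurableType d)
    (P : probability T R) (p : nat) (n : complexRV P p) (lambda : 'rV[R]_p)
    (n_full : full n)
    (n_zero_mean : cexpectation P (cvect n) = 0)
    (n_normal : complex_normal n)
    (n_spectrum : circularity_spectrum n lambda)
    (lambda_neq1 : forall k : 'I_p, lambda ord0 k != 1) :
  entropy n =
  (ln (complex.Re (\det ((pi * expR 1)%:C *: cov P (cvect n))))
   + 2^-1 * \sum_(k < p) ln (1 - lambda ord0 k ^+ 2))%:E.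
Proof.
have [l [A [m]]] := n_normal.
rewrite -/(affine_map A m) => lawX.
have mX : measurable_fun setT (stack n) by exact: measurable_stack.
have mtnth (i : 'I_(p + p)) :
  measurable_fun setT (fun t : (p + p).-tuple (measurableTypeR R) => tnth t i : R).
  exact: measurable_tnth.
have X_mean i : has_integral P (fun w => cV_of_tuple (stack n w) i ord0) (m i ord0).
  have h := has_integral_same_law mX (measurable_affine_map A m) lawX (mtnth i)
    (affine_normal_mean A m i).
  by apply: has_integral_ext h => w /=; rewrite mxE.
have cvect_n : cvect n = fun w => unstack_mx R p *m map_mx (real_complex R) (cV_of_tuple (stack n w)).
  by apply/funext => w; exact: cvectE.
(* The real and imaginary parts of the complex mean are the two halves of m, so a zero complex mean
   leaves no translation. *)
have m0 : m = 0.
  have h i (j : 'I_1) : has_integral P (fun w => cV_of_tuple (stack n w) i j) (m i j).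
    by rewrite (ord1 j); exact: X_mean.
  have := cexpectation_mulmx (unstack_mx R p) 1%:M h.
  rewrite mulmx1 (_ : (fun w => _) = cvect n); last first.
    by rewrite cvect_n; apply/funext => w; rewrite mulmx1.
  rewrite n_zero_mean unstack_mx_mulmx.
  have -> : 0 = map_mx (real_complex R) 0 + (0 +i* 1) *: map_mx (real_complex R) 0 :> 'cV[R[i]]_p.
    by rewrite map_mx0 scaler0 addr0.
  by move=> /re_im_mx_inj[mu md]; rewrite -[m]vsubmxK -mu -md col_mx0.
rewrite {}m0 in lawX X_mean.
have {}X_mean i : has_integral P (fun w => cV_of_tuple (stack n w) i ord0) 0.
  by have := X_mean i; rewrite mxE.
have X_cov i j : has_integral P
    (fun w => cV_of_tuple (stack n w) i ord0 * cV_of_tuple (stack n w) j ord0) ((A *m A^T) i j).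
  have h := has_integral_same_law mX (measurable_affine_map A 0) lawX
    (measurable_funM (mtnth i) (mtnth j)) (linear_normal_cov A i j).
  by apply: has_integral_ext h => w /=; rewrite !mxE.
have [_ lambda_ge0 [D uD [covD pcovD]]] := n_spectrum.
have Dn : (fun w => D *m cvect n w) =
    fun w => (D *m unstack_mx R p) *m map_mx (real_complex R) (cV_of_tuple (stack n w)).
  by apply/funext => w; rewrite cvectE mulmxA.
have hermM : hermitian_transpose (D *m unstack_mx R p) =
    hermitian_transpose (unstack_mx R p) *m hermitian_transpose D.
  by rewrite /hermitian_transpose map_mxM trmx_mul.
have covn := cov_mulmx X_mean X_cov (unstack_mx R p).
rewrite -cvect_n in covn.
rewrite Dn (cov_mulmx X_mean X_cov) hermM in covD.
rewrite Dn (pcov_mulmx X_mean X_cov) trmx_mul in pcovD.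
have {}covD : D *m (unstack_mx R p *m map_mx (real_complex R) (A *m A^T) *m
    hermitian_transpose (unstack_mx R p)) *m hermitian_transpose D = 1%:M.
  by rewrite -covD !mulmxA.
have {}pcovD : D *m (unstack_mx R p *m map_mx (real_complex R) (A *m A^T) *m
    (unstack_mx R p)^T) *m D^T = diag_mx (map_mx (real_complex R) lambda).
  by rewrite -pcovD !mulmxA.
have FAF := real_form_diagonalizes covD pcovD.
set delta := row_mx _ _ in FAF.
rewrite -covn in covD.
have detD0 : \det D != 0 by rewrite -unitfE -unitmxE.
have detF0 : 0 < \det (real_form D).
  by rewrite -ltcR det_real_form mul_conjC_gt0.
have uF : real_form D \in unitmx by rewrite unitmxE unitfE gt_eqF.
(* Taking determinants in D cov D^H = 1 produces the factor |det D|^2, which is the determinant of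
   the real form. *)
have det_cov : \det (cov P (cvect n)) = ((\det (real_form D))^-1)%:C.
  have := congr1 determinant covD.
  rewrite !det_mulmx /hermitian_transpose det_tr det_conj det1 mulrAC -det_real_form.
  move=> h; rewrite fmorphV; apply: (mulfI (x := (\det (real_form D))%:C)).
    by rewrite fmorph_eq0 gt_eqF.
  by rewrite h divff// fmorph_eq0 gt_eqF.
(* (1 - lambda_k)/2 is a diagonal entry of the Gram matrix of F A, hence nonnegative; lambda_k
   different from 1 makes it positive. *)
have lambda_lt1 k : lambda ord0 k < 1.
  rewrite lt_neqAle lambda_neq1/=.
  have := gram_diag_ge0 (real_form D *m A) (rshift p k).
  rewrite trmx_mul mulmxA -(mulmxA _ A) FAF mxE eqxx mulr1n /delta row_mxEr mxE.
  by move=> h; lra.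
have delta_gt0 i : 0 < delta ord0 i.
  rewrite /delta; case: (split_ordP i) => k ->; rewrite (row_mxEl, row_mxEr) mxE.
  - by have := lambda_ge0 k; lra.
  - by have := lambda_lt1 k; lra.
have [W [uW WW detW]] := gram_sqrt_diag uF FAF delta_gt0.
have QQ : (invmx W *m A) *m (invmx W *m A)^T = 1%:M.
  rewrite trmx_mul mulmxA -(mulmxA _ A) -WW mulmxA mulVmx// mul1mx.
  by rewrite -trmx_mul mulVmx// trmx1.
have lawW B : measurable B ->
    distribution P (realRV n) B = std_normalRn R (p + p) (affine_map W 0 @^-1` B).
  move=> mB; rewrite lawX// -(std_normalRn_coisometry QQ); last first.
    by rewrite -[X in measurable X]setTI; exact: measurable_affine_map.
  congr (std_normalRn R l _); apply/seteqP; suff h z :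
      affine_map W 0 (affine_map (invmx W *m A) 0 z) = affine_map A 0 z.
    by split => z /=; rewrite h.
  by rewrite affine_map_comp mulmxA mulmxV// mul1mx mulmx0 addr0.
rewrite /entropy (differential_entropy_normal uW lawW) detW detZ det_cov -rmorphXn -rmorphM/=.
congr EFin.
have pe0 : 0 < pi * expR 1 :> R by rewrite mulr_gt0 ?pi_gt0 ?expR_gt0.
rewrite ln_div ?posrE ?exprn_gt0// lnXn// [ln (pi * _)]lnM ?posrE ?pi_gt0 ?expR_gt0// expRK.
rewrite gtr0_norm// big_split_ord/=.
rewrite (eq_bigr (fun k => ln ((1 + lambda ord0 k) / 2))); last first.
  by move=> k _; rewrite /delta row_mxEl mxE.
rewrite [X in _ * (_ + X)](eq_bigr (fun k => ln ((1 - lambda ord0 k) / 2))); last first.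
  by move=> k _; rewrite /delta row_mxEr mxE.
rewrite -big_split/= (eq_bigr (fun k => ln (1 - lambda ord0 k ^+ 2) - 2 * ln 2)); last first.
  by move=> k _; rewrite ln_circularity_pair// lambda_ge0 lambda_lt1.
rewrite big_split/= sumr_const card_ord lnM ?posrE ?pi_gt0// natrD.
rewrite -[(ln pi + 1) *+ p]mulr_natr -[(- _) *+ p]mulr_natr.
(* With the logarithms generalised, what remains is arithmetic: the term p ln 2 from ln(2 pi) in
   dimension 2p cancels the p copies of - 2 ln 2, halved. *)
move: (ln pi) (ln 2) (ln (\det _)) (\sum_(i < p) _) p%:R => a b c s q; by field.
Qed.
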